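(* Let $\gamma$ be a Jordan curve (a simple closed curve) in the plane $\mathbb{R}^2$ that has bounded convex curvature. Then the interior $\operatorname{Int}\gamma$ contains an open disk of radius $1$.
   Context: For a Jordan curve $\gamma$, $\operatorname{Int}\gamma$ and $\operatorname{Ext}\gamma$ denote the bounded and unbounded components of $\mathbb{R}^2\setminus\gamma$. $B(x,\varepsilon)$ denotes the open disk of center $x$ and radius $\varepsilon$. A Jordan curve $\gamma$ has bounded convex curvature if for every point $x\in\gamma$ there exist an open disk $U_x$ of radius $1$ and $\varepsilon_x>0$ such that $x\in\partial U_x$ and $B(x,\varepsilon_x)\cap U_x\subset\operatorname{Int}\gamma$. No differentiability of $\gamma$ is assumed. *)

(* Defs.v *)
From HB Require Import structures.
From mathcomp Require Import all_boot all_order all_algebra.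
From mathcomp Require Import all_classical all_reals all_analysis.
Set Implicit Arguments. Unset Strict Implicit. Unset Printing Implicit Defensive.
Import Order.TTheory GRing.Theory Num.Theory.
Import numFieldNormedType.Exports.
Local Open Scope classical_set_scope.
Local Open Scope ring_scope.

Definition sqdist {R : realType} (x y : R * R) : R :=
  (x.1 - y.1) ^+ 2 + (x.2 - y.2) ^+ 2.

Definition edisk {R : realType} (c : R * R) (r : R) : set (R * R) :=
  [set y | sqdist c y < r ^+ 2].

Definition ecircle {R : realType} (c : R * R) (r : R) : set (R * R) :=
  [set y | sqdist c y = r ^+ 2].

Definition bounded_plane {R : realType} (S : set (R * R)) : Prop :=
  exists M : R, forall y, S y -> `|y.1| <= M /\ `|y.2| <= M.

Definition jordan_param {R : realType} (f : R -> R * R) : Prop :=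
  [/\ {within `[0, 1], continuous f}, f 0 = f 1 &
      {in `[0, 1[ &, injective f}].

Definition curve {R : realType} (f : R -> R * R) : set (R * R) :=
  f @` `[0, 1]%classic.

(* Int gamma: the union of the bounded connected components of R^2 \ gamma
   (by the Jordan curve theorem there is exactly one such component). *)
Definition Int {R : realType} (gam : set (R * R)) : set (R * R) :=
  [set x | ~ gam x /\ bounded_plane (connected_component (~` gam) x)].

Definition bounded_convex_curvature {R : realType} (gam : set (R * R)) : Prop :=
  forall x, gam x ->
    exists c : R * R, ecircle c 1 x /\
      exists2 eps : R, 0 < eps & edisk x eps `&` edisk c 1 `<=` Int gam.

(* Main.v *)
Require Import Defs.
From mathcomp Require Import all_boot all_order all_algebra.
From mathcomp Require Import all_classical all_reals all_analysis.
From mathcomp Require Import ring lra.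
Set Implicit Arguments. Unset Strict Implicit. Unset Printing Implicit Defensive.
Import Order.TTheory GRing.Theory Num.Theory.
Import numFieldNormedType.Exports.
Local Open Scope classical_set_scope.
Local Open Scope ring_scope.

(** Suppose the interior contains no unit disk.  Call a disk inscribed at the
    pair s < t if it lies in the interior and touches the curve at F s and F t.
    Growing a disk that is tangent from inside at a given point gives an
    inscribed disk with a second contact.  Chords of two inscribed disks do not
    cross (the radical axis separates them), so starting from the middle of an
    arc [s, t] the second contact is again in [s, t], and there are inscribed
    disks at pairs with arbitrarily short arcs, of radii bounded away from 1.
    For a short arc choose a disk of radius < 1 through F s and F t that bulges
    less than the inscribed one, with center q; the arc leaves it, so |F - q| has
    a maximum < 1 at an inner point of the arc.  There the region enclosed by the
    arc and its chord lies in a disk of radius < 1 with the point on its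
    boundary, so the unit disk U_x does not fit locally in the interior.

    The topology is done with winding numbers.  For z in a bounded component of
    the complement of a compact set X, the function y - z has no continuous
    argument on X (Borsuk): otherwise, extending it by Tietze one would get a
    map from a disk to the circle that is the radial one on the boundary.  Hence
    interior points have nonzero winding number, arcs do not separate the plane,
    and a chord inside an inscribed disk splits the curve as expected. *)

(** * Angles and continuous arguments *)

Section Angles.
Context {R : realType}.
Implicit Types (u v z : R * R) (th : R).

Definition dot u v : R := u.1 * v.1 + u.2 * v.2.
Definition cross u v : R := u.1 * v.2 - u.2 * v.1.
(** The signed angle from [u] to [v], meaningful when [dot u v > 0]: it then lies in the range of
    [atan], and no branch has to be chosen. *)
Definition angle u v : R := atan (cross u v / dot u v).
Definition polar u th : Prop :=
  exists2 N : R, 0 < N & u = (N * cos th, N * sin th).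

Lemma dot_ge0 u : 0 <= dot u u.
Proof. by rewrite /dot -!expr2 addr_ge0 ?sqr_ge0. Qed.

Lemma dot_gt0 u : u != 0 -> 0 < dot u u.
Proof.
move=> u0; rewrite lt_neqAle dot_ge0 andbT eq_sym; apply: contra u0.
rewrite /dot -!expr2 paddr_eq0 ?sqr_ge0// !sqrf_eq0 => /andP[/eqP h1 /eqP h2].
by rewrite [u]surjective_pairing h1 h2.
Qed.

Lemma cauchy_schwarz u v : dot u v ^+ 2 <= dot u u * dot v v.
Proof.
rewrite -subr_ge0 (_ : _ - _ = cross u v ^+ 2) ?sqr_ge0//.
by rewrite /dot /cross; ring.
Qed.

(** By Cauchy-Schwarz, adding a vector shorter than [u] cannot turn [u] by a right angle. Small
    displacements and far points are handled through this. *)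
Lemma dot_perturb u v : dot v v < dot u u -> 0 < dot u (u + v).
Proof.
move=> h; have := cauchy_schwarz u v.
rewrite (_ : dot u (u + v) = dot u u + dot u v); last by rewrite /dot/=; ring.
move: h (dot_ge0 v); nra.
Qed.

Lemma polar_angle u v th :
  polar u th -> 0 < dot u v -> polar v (th + angle u v).
Proof.
move=> [N N0 uE] d0; rewrite /angle; set k := _ / _.
have C0 : 0 < cos (atan k).
  by rewrite cos_atan invr_gt0 sqrtr_gt0 ltr_wpDr// sqr_ge0.
have sE : sin (atan k) = k * cos (atan k).
  by rewrite -{2}(atanK k) /tan divfK// gt_eqF.
exists (dot u v / (N * cos (atan k))); first by rewrite divr_gt0// mulr_gt0.
rewrite cosD sinD sE.
have kE : k * dot u v = cross u v by rewrite divfK// gt_eqF.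
have h1 : dot u v * cos th - cross u v * sin th = N * v.1.
  have := cos2Dsin2 th; rewrite /dot /cross uE /= => e.
  rewrite -[RHS]mulr1 -e; ring.
have h2 : dot u v * sin th + cross u v * cos th = N * v.2.
  have := cos2Dsin2 th; rewrite /dot /cross uE /= => e.
  rewrite -[RHS]mulr1 -e; ring.
have N0' : N != 0 by rewrite gt_eqF.
have C0' : cos (atan k) != 0 by rewrite gt_eqF.
rewrite [v in LHS]surjective_pairing; congr pair.
  apply: (mulfI N0'); rewrite -h1 -kE; field; exact/andP.
apply: (mulfI N0'); rewrite -h2 -kE; field; exact/andP.
Qed.

Lemma polar_ex u : u != 0 -> exists th, polar u th.
Proof.
move=> /dot_gt0 u0; set N := Num.sqrt (dot u u).
have N0 : 0 < N by rewrite sqrtr_gt0.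
have NN : N ^+ 2 = u.1 ^+ 2 + u.2 ^+ 2 by rewrite sqr_sqrtr ?ltW//.
have N0' : N != 0 by rewrite gt_eqF.
have b : -1 <= u.1 / N <= 1.
  rewrite ler_pdivrMr// ler_pdivlMr//.
  by have := sqr_ge0 u.2; nra.
have c : cos (acos (u.1 / N)) = u.1 / N by rewrite acosK// in_itv.
have s2 : sin (acos (u.1 / N)) ^+ 2 = (u.2 / N) ^+ 2.
  rewrite sin2cos2 c !expr_div_n NN; field; rewrite -NN; exact: expf_neq0.
move/eqP: s2; rewrite eqf_sqr => /orP[] /eqP s.
  exists (acos (u.1 / N)), N => //; rewrite c s.
  by rewrite !(mulrC N) !divfK// -surjective_pairing.
exists (- acos (u.1 / N)), N => //; rewrite cosN sinN c s opprK.
by rewrite !(mulrC N) !divfK// -surjective_pairing.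
Qed.

(** Two arguments differ by a multiple of 2 pi; stating this as [cos = 1] avoids producing the
    integer. *)
Lemma polar_cos u th ph : polar u th -> polar u ph -> cos (th - ph) = 1.
Proof.
move=> [N N0 ->] [M M0 [e1 e2]].
have sq (r x : R) : r ^+ 2 = (r * cos x) ^+ 2 + (r * sin x) ^+ 2.
  by rewrite !exprMn -mulrDr cos2Dsin2 mulr1.
have : N ^+ 2 = M ^+ 2 by rewrite (sq N th) (sq M ph) e1 e2.
move=> /eqP; rewrite eqrXn2 ?ltW// => /eqP NM; subst M.
have N0' : N != 0 by rewrite gt_eqF.
by rewrite cosB (mulfI N0' e1) (mulfI N0' e2) -!expr2 cos2Dsin2.
Qed.

(** Two values at least pi apart would, by the intermediate value theorem, give a point where the
    cosine is -1. Distinct values less than pi apart contradict the injectivity of the cosine on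
    [0, pi]. *)
Lemma cos1_const (ph : R -> R) (a b : R) : a <= b ->
  (forall x, a <= x <= b -> {for x, continuous ph}) ->
  (forall x, a <= x <= b -> cos (ph x) = 1) -> ph a = ph b.
Proof.
move=> ab.
have key (f : R -> R) : (forall x, a <= x <= b -> {for x, continuous f}) ->
    (forall x, a <= x <= b -> cos (f x) = 1) -> f a < f b -> False.
  move=> cf f1 fab.
  have aab : a <= a <= b by rewrite lexx.
  have bab : a <= b <= b by rewrite lexx andbT.
  have s0 x : a <= x <= b -> sin (f x) = 0.
    move=> /f1 h; apply/eqP; rewrite -sqrf_eq0; have := cos2Dsin2 (f x).
    by rewrite h expr1n => /eqP; rewrite -subr_eq0 addrAC subrr add0r.
  have [h|h] := leP (f a + pi) (f b).
    have := @IVT R f a b (f a + pi) ab.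
    case.
    - by apply: continuous_in_subspaceT => x /set_mem/=; rewrite in_itv/=; exact: cf.
    - rewrite ge_min le_max h lerDl pi_ge0 /= orbT//.
    - move=> c cab fc; move: cab; rewrite in_itv/= => /f1.
      rewrite fc cosDpi (f1 a)// => /eqP; lra.
  have : cos (f b - f a) = cos 0.
    by rewrite cosB !f1// !s0// cos0; ring.
  move/(@cos_inj R); rewrite !in_itv/= lexx pi_ge0 subr_ge0 ltW//=.
  rewrite lerBlDr addrC ltW// => /(_ isT isT) /eqP; rewrite subr_eq0 => /eqP e.
  by rewrite e ltxx in fab.
move=> cph h; apply/eqP; rewrite eq_le; apply/andP; split; rewrite leNgt; apply/negP => l.
  apply: (key (fun x => - ph x)) => [x xab|x xab|]; last by rewrite ltrN2.
    by apply: continuousN; exact: cph.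
  by rewrite cosN h.
exact: (key ph).
Qed.

(** Supplies the exact constant pi in [wchorded_jump]. *)
Lemma atanD_inv (x : R) : 0 < x -> atan x + atan x^-1 = pi / 2.
Proof.
move=> x0.
have a0 : 0 < atan x by rewrite -(@atan0 R) lt_atan.
have a1 := atan_ltpi2 x.
have c0 : cos (atan x) != 0.
  by rewrite cos_atan gt_eqF// invr_gt0 sqrtr_gt0 ltr_wpDr// sqr_ge0.
have s0 : sin (atan x) != 0.
  by apply: contraTneq x0; rewrite -{2}(atanK x) /tan => ->; rewrite mul0r ltxx.
suff -> : x^-1 = tan (pi / 2 - atan x).
  rewrite tanK; first by rewrite addrC subrK.
  rewrite in_itv/=; have := pi_gt0 R; move: a0 a1; lra.
rewrite -{1}(atanK x) /tan sinB cosB cos_pihalf sin_pihalf.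
by rewrite !mul0r mul1r !subr0 add0r mul1r invf_div.
Qed.

End Angles.

Section Lifts.
Context {R : realType}.

Lemma cvg_fst1 {T : Type} (F : set_system T) {FF : Filter F} (f : T -> R * R) (a : R * R) :
  f @ F --> a -> (f x).1 @[x --> F] --> a.1.
Proof. by move=> fa; apply: (cvg_comp _ _ fa); exact: cvg_fst. Qed.

Lemma cvg_snd2 {T : Type} (F : set_system T) {FF : Filter F} (f : T -> R * R) (a : R * R) :
  f @ F --> a -> (f x).2 @[x --> F] --> a.2.
Proof. by move=> fa; apply: (cvg_comp _ _ fa); exact: cvg_snd. Qed.

Lemma cvg_dot {T : Type} (F : set_system T) {FF : Filter F} (f g : T -> R * R) (a b : R * R) :
  f @ F --> a -> g @ F --> b -> dot (f x) (g x) @[x --> F] --> dot a b.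
Proof.
by move=> fa gb; apply: cvgD; apply: cvgM; (exact: cvg_fst1 || exact: cvg_snd2).
Qed.

Lemma cvg_cross {T : Type} (F : set_system T) {FF : Filter F} (f g : T -> R * R) (a b : R * R) :
  f @ F --> a -> g @ F --> b -> cross (f x) (g x) @[x --> F] --> cross a b.
Proof.
by move=> fa gb; apply: cvgB; apply: cvgM; (exact: cvg_fst1 || exact: cvg_snd2).
Qed.

Lemma cvg_angle {T : Type} (F : set_system T) {FF : Filter F} (f g : T -> R * R) (a b : R * R) :
  0 < dot a b ->
  f @ F --> a -> g @ F --> b -> angle (f x) (g x) @[x --> F] --> angle a b.
Proof.
move=> ab fa gb.
apply: (@cvg_comp _ _ _ (fun x => cross (f x) (g x) / dot (f x) (g x)) atan);
  last exact: continuous_atan.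
apply: cvgM; first exact: cvg_cross.
by apply: cvgV; [rewrite gt_eqF|exact: cvg_dot].
Qed.

Lemma compact_uniform (V : normedModType R) (P : V * V -> Prop) (K : set V) :
  compact K -> (forall x, K x -> \forall p \near (x, x), P p) ->
  exists2 d : R, 0 < d & forall u v, K u -> `|u - v| < d -> P (u, v).
Proof.
move=> /compact_near_coveringP nc hP.
have : \forall d \near 0^'+, K `<=` (fun u => forall v, `|u - v| < d -> P (u, v)).
  apply: nc => x /hP /nbhs_ballP[e /= e0 He].
  exists (ball x (e / 2), [set d | d < e / 2]) => /=.
    split; first by apply: nbhsx_ballx; rewrite divr_gt0.
    by apply: nbhs_right_lt; rewrite divr_gt0.
  move=> [u d] /= [xu de] v uv; apply: (He (u, v)); split => /=.
    by apply: le_ball xu; rewrite ler_pdivrMr// ler_peMr// ?ltW// ltr1n.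
  have -> : e = e / 2 + e / 2 by rewrite -splitr.
  apply: (ball_triangle xu); rewrite -ball_normE /=; exact: lt_trans uv de.
move=> /(filterI (nbhs_right_gt 0))/filter_ex[d [d0 Hd]].
by exists d => // u v Ku; exact: Hd.
Qed.

(** The argument at [v] is the one at [x0] plus the small angles along the segment from [x0] to [v].
    The number of pieces does not depend on [v], so the sum is continuous in [v]. *)
Lemma lift_star (V : normedModType R) (h : V -> R * R) (K : set V) (x0 : V) :
  compact K -> K x0 ->
  (forall v (l : R), K v -> 0 <= l <= 1 -> K (x0 + l *: (v - x0))) ->
  continuous h -> (forall v, K v -> h v != 0) ->
  exists th : V -> R, forall v, K v ->
    {for v, continuous th} /\ polar (h v) (th v).
Proof.
move=> cK Kx0 star ch h0.
have [|d d0 Hd] := @compact_uniform V (fun p => 0 < dot (h p.1) (h p.2)) K cK.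
  move=> x Kx; have cd : dot (h p.1) (h p.2) @[p --> (x, x)] --> dot (h x) (h x).
    apply: cvg_dot.
      by apply: (@cvg_comp _ _ _ fst h); [exact: cvg_fst|exact: ch].
    by apply: (@cvg_comp _ _ _ snd h); [exact: cvg_snd|exact: ch].
  by apply: (cvgr_gt _ cd); exact/dot_gt0/h0.
have [M [Mr HM]] := compact_bounded cK.
pose B : R := Num.max M 0 + 1 + `|x0|.
have B0 : 0 < B by rewrite /B -addrA ltr_wpDl ?le_max ?lexx ?orbT// ltr_pwDl.
have KB v : K v -> `|v - x0| <= B.
  move=> Kv; apply: (le_trans (ler_normB _ _)); rewrite lerD2r.
  by apply: HM Kv; rewrite ltr_pwDr// le_max lexx.
(* [B] bounds all segments issued from [x0], so [n.+1] equal pieces are shorter than [d], and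
   consecutive values of [h] make an acute angle. *)
have [n nBd] : exists n : nat, B / d < n.+1%:R.
  exists (Num.truncn (B / d)).
  by rewrite truncnS_gt.
pose pt (k : nat) (v : V) := x0 + (k%:R / n.+1%:R) *: (v - x0).
have ptK k v : (k <= n.+1)%N -> K v -> K (pt k v).
  move=> kn Kv; apply: star => //.
  by rewrite divr_ge0//= ler_pdivrMr// mul1r ler_nat.
have pt_dot k v : (k < n.+1)%N -> K v -> 0 < dot (h (pt k v)) (h (pt k.+1 v)).
  move=> kn Kv; apply: (Hd (pt k v) (pt k.+1 v)); first exact/ptK/Kv/ltnW.
  rewrite /pt opprD addrACA subrr add0r -scalerBl normrZ -mulrBl -natr1.
  rewrite opprD addrA subrr add0r mulN1r normrN ger0_norm ?invr_ge0//.
  rewrite mulrC ltr_pdivrMr//; apply: (le_lt_trans (KB _ Kv)).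
  by rewrite mulrC -ltr_pdivrMr.
have [th0 p0] := polar_ex (h0 _ Kx0).
pose th v := th0 + \sum_(k < n.+1) angle (h (pt k v)) (h (pt k.+1 v)).
have cpt k : continuous (pt k).
  move=> v; apply: cvgD; first exact: cvg_cst.
  apply: cvgZ; first exact: cvg_cst.
  by apply: cvgB; [exact: cvg_id|exact: cvg_cst].
exists th => v Kv; split.
  apply: cvgD; first exact: cvg_cst.
  have : forall m, (m <= n.+1)%N -> {for v, continuous
      (fun v => \sum_(k < m) angle (h (pt k v)) (h (pt k.+1 v)))}.
    elim=> [|m IH] mn.
      rewrite (_ : (fun _ => _) = cst 0); first exact: cvg_cst.
      by apply/funext => w; rewrite big_ord0.
    rewrite (_ : (fun _ => _) = fun v => \sum_(k < m) angle (h (pt k v)) (h (pt k.+1 v))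
       + angle (h (pt m v)) (h (pt m.+1 v))); last first.
      by apply/funext => w; rewrite big_ord_recr.
    apply: cvgD; first exact/IH/ltnW.
    apply: cvg_angle; first exact: pt_dot.
      by apply: (@cvg_comp _ _ _ (pt m) h); [exact: cpt|exact: ch].
    by apply: (@cvg_comp _ _ _ (pt m.+1) h); [exact: cpt|exact: ch].
  exact.
have : forall m, (m <= n.+1)%N ->
    polar (h (pt m v)) (th0 + \sum_(k < m) angle (h (pt k v)) (h (pt k.+1 v))).
  elim=> [|m IH] mn.
    by rewrite big_ord0 addr0 /pt mul0r scale0r addr0.
  rewrite big_ord_recr/= addrA; apply: polar_angle; last exact: pt_dot.
  exact/IH/ltnW.
move=> /(_ n.+1 (leqnn _)); congr (polar (h _) _).
by rewrite /pt divff ?scale1r ?subrKC// pnatr_eq0.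
Qed.

End Lifts.

(** * Variation of the argument along a path *)

Section Variation.
Context {R : realType}.
Implicit Types (g h : R -> R * R) (s t : R).

Definition is_lift g s t (th : R -> R) : Prop :=
  forall x, s <= x <= t -> {for x, continuous th} /\ polar (g x) (th x).

(** By [is_lift_uniq] the choice of the lift does not matter. The default 0 is taken when there is
    no lift, for instance when the path meets the origin. *)
Definition Var g s t : R :=
  xget 0 [set v | exists2 th, is_lift g s t th & v = th t - th s].

Lemma is_lift_uniq g s t th ph : s <= t ->
  is_lift g s t th -> is_lift g s t ph -> th t - th s = ph t - ph s.
Proof.
move=> st Lth Lph.
have : th s - ph s = th t - ph t.
  apply: (@cos1_const _ (fun x => th x - ph x)) => // x /[dup] /Lth[c p] /Lph[d q].
    exact: cvgB.
  exact: polar_cos p q.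
lra.
Qed.

Lemma VarE g s t th : s <= t -> is_lift g s t th -> Var g s t = th t - th s.
Proof.
move=> st L; rewrite /Var; case: xgetP => [v _ [ph Lph ->]|/(_ (th t - th s))].
  exact: is_lift_uniq Lph L.
by case; exists th.
Qed.

Lemma lift_path g s t : s <= t -> continuous g ->
  (forall x, s <= x <= t -> g x != 0) -> exists th, is_lift g s t th.
Proof.
move=> st cg g0.
have sI x : `[s, t]%classic x = (s <= x <= t) by rewrite /= in_itv.
have [] := @lift_star _ _ g `[s, t]%classic s (@segment_compact _ s t) _ _ cg.
- by rewrite sI lexx.
- move=> v l; rewrite !sI => /andP[sv vt] /andP[l0 l1].
  have h0 : 0 <= l * (v - s) by rewrite mulr_ge0// subr_ge0.
  have h1 : 0 <= (1 - l) * (v - s) by rewrite mulr_ge0// subr_ge0.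
  rewrite -[l *: _]/(l * (v - s)); lra.
- by move=> v; rewrite sI; exact: g0.
- by move=> th H; exists th => x; rewrite -sI; exact: H.
Qed.

Lemma VarD g s t u : s <= t -> t <= u -> continuous g ->
  (forall x, s <= x <= u -> g x != 0) -> Var g s u = Var g s t + Var g t u.
Proof.
move=> st tu cg g0; have su := le_trans st tu.
have [th L] := lift_path su cg g0.
rewrite !(@VarE _ _ _ th)//; first by ring.
  by move=> x /andP[tx xu]; apply: L; rewrite xu (le_trans st).
by move=> x /andP[sx xt]; apply: L; rewrite sx (le_trans xt).
Qed.

Lemma dot_neq0l (u v : R * R) : 0 < dot u v -> u != 0.
Proof. by apply: contraTneq => ->; rewrite /dot !mul0r addr0 ltxx. Qed.

(** A lift of [g] plus the angle from [g] to [h] is a lift of [h], so only the endpoint angles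
    enter. Around a loop they cancel, which makes winding numbers locally constant. *)
Lemma Var_perturb g h s t : s <= t -> continuous g -> continuous h ->
  (forall x, s <= x <= t -> 0 < dot (g x) (h x)) ->
  Var h s t = Var g s t + angle (g t) (h t) - angle (g s) (h s).
Proof.
move=> st cg ch d0.
have [th L] := lift_path st cg (fun x xst => dot_neq0l (d0 x xst)).
rewrite (VarE st L) (@VarE h s t (fun x => th x + angle (g x) (h x)))//; first by ring.
move=> x xst; have [c p] := L x xst; split.
  by apply: cvgD; [exact: c|apply: cvg_angle; [exact: d0|exact: cg|exact: ch]].
exact: polar_angle p (d0 x xst).
Qed.

Lemma Var_halfplane g s t (n : R * R) : s <= t -> continuous g ->
  (forall x, s <= x <= t -> 0 < dot n (g x)) ->
  Var g s t = angle n (g t) - angle n (g s).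
Proof.
move=> st cg d0; have [|th p] := @polar_ex _ n.
  by apply: dot_neq0l (d0 s _); rewrite lexx.
rewrite (@VarE g s t (fun x => th + angle n (g x)))//; first by ring.
move=> x xst; split; last exact: polar_angle p (d0 x xst).
apply: cvgD; first exact: cvg_cst.
by apply: cvg_angle; [exact: d0|exact: cvg_cst|exact: cg].
Qed.

Lemma Var_rev g h : continuous g -> (forall x, 0 <= x <= 1 -> g x != 0) ->
  (forall x, h x = g (1 - x)) -> Var h 0 1 = - Var g 0 1.
Proof.
move=> cg g0 hg; have [th L] := lift_path ler01 cg g0.
rewrite (VarE ler01 L) (@VarE h 0 1 (fun x => th (1 - x)))//.
  by rewrite subrr subr0 opprB.
move=> x x01; have [|c p] := L (1 - x); first lra.
rewrite hg; split=> //.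
apply: (@cvg_comp _ _ _ (fun x => 1 - x) th); last exact: c.
by apply: cvgB; [exact: cvg_cst|exact: cvg_id].
Qed.

Lemma Var_shift g s t : s <= t -> continuous g ->
  (forall x, g (x + 1) = g x) -> (forall x, s <= x <= t -> g x != 0) ->
  Var g (s + 1) (t + 1) = Var g s t.
Proof.
move=> st cg per g0; have [th L] := lift_path st cg g0.
rewrite (VarE st L) (@VarE g _ _ (fun x => th (x - 1))) ?lerD2r//.
  by rewrite !addrK.
move=> x x01; have [|c p] := L (x - 1); first lra.
rewrite -per subrK in p; split=> //.
apply: (@cvg_comp _ _ _ (fun x => x - 1) th); last exact: c.
by apply: cvgB; [exact: cvg_id|exact: cvg_cst].
Qed.

End Variation.

(** * Borsuk's criterion *)

Section Borsuk.
Context {R : realType}.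

(** On a compact interval [F] is a closed map, so [th], being constant on fibres, descends to a
    continuous function on the image; Tietze's theorem extends it to the plane. *)
Lemma descend_extend (F : R -> R * R) (th : R -> R) (s t : R) : s <= t ->
  continuous F ->
  (forall x, s <= x <= t -> {for x, continuous th}) ->
  (forall x y, s <= x <= t -> s <= y <= t -> F x = F y -> th x = th y) ->
  exists2 g : R * R -> R, continuous g & forall x, s <= x <= t -> g (F x) = th x.
Proof.
move=> st cF cth fac.
have sI x : `[s, t]%classic x = (s <= x <= t) by rewrite /= in_itv.
pose X := F @` `[s, t]%classic.
have cptI : compact `[s, t]%classic by exact: segment_compact.
have clF (C : set R) : closed C -> closed (F @` (`[s, t]%classic `&` C)).
  move=> cC; apply: compact_closed; first exact: norm_hausdorff.
  apply: continuous_compact; first exact: continuous_subspaceT.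
  exact: compact_closedI.
have clX : closed X by have := clF setT closedT; rewrite setIT.
pose g0 y := th (xget s [set u | s <= u <= t /\ F u = y]).
have g0F x : s <= x <= t -> g0 (F x) = th x.
  move=> xst; rewrite /g0; case: xgetP => [u _ [ust Fu]|/(_ x)]; last by case.
  exact: fac.
have cth' : {within `[s, t]%classic, continuous th}.
  apply: continuous_in_subspaceT => x /set_mem; rewrite sI; exact: cth.
have cg0 : {within X, continuous g0}.
  apply/continuous_closedP => C cC.
  move/continuous_closedP : cth' => /(_ _ cC) /closed_subspaceP[V cV Vth].
  apply/closed_subspaceP; exists (F @` (`[s, t]%classic `&` V)); first exact: clF.
  apply/seteqP; split => y /= [].
    move=> [x [xst Vx] <-] XFx; split => //.
    by have : C (th x); [have : (V `&` `[s, t]%classic) x by []; rewrite Vth => -[]|rewrite -g0F -?sI].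
  rewrite /from_subspace => + [x xst xy]; rewrite -xy g0F -?sI// => Cx.
  have : (th @^-1` C `&` `[s, t]%classic) x by [].
  rewrite -Vth => -[Vx _]; split; exists x => //.
have [M [_ HM]] := compact_bounded (continuous_compact cth' cptI).
pose B := Num.max M 0 + 1.
have B0 : 0 < B by rewrite ltr_wpDl// le_max lexx orbT.
have MB : M < B by rewrite ltr_pwDr// le_max lexx.
have bg0 y : X y -> `|g0 y| <= B.
  move=> [x xst <-]; rewrite g0F -?sI//; apply: (HM _ MB); by exists x.
have [g [gE cg _]] := continuous_bounded_extension
  (@pseudometric_normal R (R * R)%type) clX B0 cg0 bg0.
exists g => // x xst; rewrite -g0F// gE// inE; exists x => //; by rewrite sI.
Qed.

Lemma cvg_pair2 {T : Type} (G : set_system T) {FG : Filter G} (f g : T -> R) (a b : R) :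
  f @ G --> a -> g @ G --> b -> (f x, g x) @[x --> G] --> (a, b).
Proof. exact: cvg_pair. Qed.

(** The unit field of angle [g] on [W] and the radial field from [x] outside [W] glue to a
    nonvanishing continuous field on the plane. Lifting its argument over a square would give a
    continuous polar angle on a whole circle around [x]. *)
Lemma borsuk (F : R -> R * R) (th : R -> R) (s t M : R) (x : R * R) (W : set (R * R)) :
  s <= t -> continuous F -> is_lift (fun u => F u - x) s t th ->
  (forall u v, s <= u <= t -> s <= v <= t -> F u = F v -> th u = th v) ->
  open W -> W x -> 0 < M -> W `<=` edisk x M ->
  closure W `<=` W `|` F @` `[s, t]%classic -> False.
Proof.
move=> st cF L fac oW Wx M0 WM clW.
have [g cg gF] := descend_extend st cF (fun u ust => (L u ust).1) fac.
pose h1 y := (cos (g y), sin (g y)).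
pose h2 y := (Num.sqrt (dot (y - x) (y - x)))^-1 *: (y - x).
pose h y := if `[< W y >] then h1 y else h2 y.
have ch1 : continuous h1.
  move=> y; apply: cvg_pair2.
    by apply: (@cvg_comp _ _ _ g cos); [exact: cg|exact: continuous_cos].
  by apply: (@cvg_comp _ _ _ g sin); [exact: cg|exact: continuous_sin].
have sq0 y : y != x -> 0 < Num.sqrt (dot (y - x) (y - x)).
  by move=> yx; rewrite sqrtr_gt0 dot_gt0// subr_eq0.
have csub : continuous (fun y : R * R => y - x).
  by move=> y; apply: cvgB; [exact: cvg_id|exact: cvg_cst].
have ch2 y : y != x -> {for y, continuous h2}.
  move=> yx; apply: cvgZ; last exact: csub.
  apply: cvgV; first by rewrite gt_eqF// sq0.
  apply: (@cvg_comp _ _ _ (fun y => dot (y - x) (y - x)) Num.sqrt); last exact: sqrt_continuous.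
  by apply: cvg_dot; exact: csub.
have Nx y : ~ W y -> y != x by move=> Wy; apply/eqP => yx; rewrite yx in Wy.
have ch : continuous h.
  move=> y A hA; change (nbhs y (h @^-1` A)).
  have [Wy|Wy] := pselect (W y).
    have hA1 : nbhs (h1 y) A by move: hA; rewrite /h asboolT.
    have n1 : nbhs y (h1 @^-1` A) := ch1 _ _ hA1.
    have nW : nbhs y W by exact: open_nbhs_nbhs.
    apply: filterS (filterI nW n1) => z [Wz A1] /=.
    by rewrite /h asboolT.
  have hA2 : nbhs (h2 y) A by move: hA; rewrite /h asboolF.
  have n2 : nbhs y (h2 @^-1` A) := ch2 _ (Nx _ Wy) _ hA2.
  have [cW|ncW] := pselect (closure W y); last first.
    have oc : nbhs y (~` closure W).
      by apply: open_nbhs_nbhs; split=> //; apply: closed_openC; exact: closed_closure.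
    apply: filterS (filterI oc n2) => z [nz A2] /=; rewrite /h asboolF// => Wz; apply: nz.
    exact: subset_closure.
  (* A boundary point of [W] lies on the path, where [g] equals [th] and the two fields agree. *)
  have [//|[u ust Fu]] := clW _ cW.
  have ust' : s <= u <= t by move: ust; rewrite /= in_itv.
  have h12 : h1 y = h2 y.
    have [_ [N N0 e]] := L u ust'.
    rewrite -Fu /h1 /h2 gF// e (_ : dot _ _ = N ^+ 2).
      rewrite sqrtr_sqr gtr0_norm// /GRing.scale/=.
      by congr pair; rewrite -[RHS]/(N^-1 * (N * _)) mulKf ?gt_eqF.
    by rewrite -[RHS]mulr1 -(cos2Dsin2 (th u)) /dot/=; ring.
  have n1 : nbhs y (h1 @^-1` A) by apply: (ch1 y); rewrite h12.
  apply: filterS (filterI n1 n2) => z [A1 A2] /=.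
  by rewrite /h; case: asboolP.
have h0 y : h y != 0.
  rewrite /h; case: asboolP => [Wy|/Nx Wy].
    apply/eqP => -[c0 s0]; have := cos2Dsin2 (g y).
    by rewrite c0 s0 expr0n/= addr0 => /esym/eqP; rewrite oner_eq0.
  by rewrite scaler_eq0 negb_or invr_eq0 gt_eqF ?sq0// subr_eq0.
(* The square is star-shaped about [x] and contains the circle of radius [M], on which [h] is the
   radial field. *)
pose K : set (R * R) := `[x.1 - M, x.1 + M]%classic `*` `[x.2 - M, x.2 + M]%classic.
have KE z : K z <-> (x.1 - M <= z.1 <= x.1 + M) /\ (x.2 - M <= z.2 <= x.2 + M).
  by rewrite /K /= !in_itv.
have [] := @lift_star _ _ h K x _ _ _ ch (fun v _ => h0 v).
- by apply: compact_setX; exact: segment_compact.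
- by apply/KE; split; apply/andP; split; lra.
- move=> v l /KE[/andP[a1 a2] /andP[b1 b2]] /andP[l0 l1]; apply/KE => /=.
  rewrite /GRing.scale/=; split; apply/andP; split; nra.
move=> Th HTh.
pose c tau : R * R := (x.1 + M * cos tau, x.2 + M * sin tau).
have cc : continuous c.
  move=> tau; apply: cvg_pair2; apply: cvgD; (try exact: cvg_cst); apply: cvgM; (try exact: cvg_cst).
    exact: continuous_cos.
  exact: continuous_sin.
have Kc tau : K (c tau).
  apply/KE; rewrite /c/=; have := cos_max tau; have := sin_max tau.
  rewrite !ler_norml => /andP[? ?] /andP[? ?]; split; apply/andP; split; nra.
have dc tau : dot (c tau - x) (c tau - x) = M ^+ 2.
  rewrite -[RHS]mulr1 -(cos2Dsin2 tau) /dot /c/=; ring.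
have nWc tau : ~ W (c tau).
  move=> /WM; rewrite /edisk/= => hlt; have := dc tau; rewrite /dot/= => e.
  move: hlt; rewrite ltNge => /negP; apply; rewrite -e /sqdist/=; nra.
have pc tau : polar (h (c tau)) tau.
  exists 1 => //; rewrite /h asboolF ?nWc// /h2 dc sqrtr_sqr gtr0_norm//.
  rewrite !mul1r; congr pair.
    by rewrite -[LHS]/(M^-1 * (x.1 + M * cos tau - x.1)) addrAC subrr add0r mulKf ?gt_eqF.
  by rewrite -[LHS]/(M^-1 * (x.2 + M * sin tau - x.2)) addrAC subrr add0r mulKf ?gt_eqF.
have : Th (c 0) - 0 = Th (c (2 * pi)) - 2 * pi.
  apply: (@cos1_const _ (fun tau => Th (c tau) - tau)).
  - by rewrite mulr_ge0// pi_ge0.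
  - move=> tau _; apply: cvgB; last exact: cvg_id.
    by apply: (@cvg_comp _ _ _ c Th); [exact: cc|exact: (HTh _ (Kc tau)).1].
  - move=> tau _; exact: polar_cos (HTh _ (Kc tau)).2 (pc tau).
have -> : c (2 * pi) = c 0.
  by rewrite /c mulr_natl cos2pi sin2pi cos0 sin0.
have := @pi_gt0 R; lra.
Qed.

End Borsuk.

(** * Winding numbers of curves closed by a chord *)

Section Winding.
Context {R : realType}.
Implicit Types (a b n y z : R * R) (X : set (R * R)) (s t : R).

Lemma ball_pairE z y (e : R) :
  ball z e y <-> `|z.1 - y.1| < e /\ `|z.2 - y.2| < e.
Proof. by rewrite (_ : ball z e y = (ball z.1 e y.1 /\ ball z.2 e y.2)). Qed.

Lemma near_dot X z0 : closed X -> ~ X z0 ->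
  \forall z \near z0, forall y, X y -> 0 < dot (y - z0) (y - z).
Proof.
move=> cX nX.
have : nbhs z0 (~` X) by apply: open_nbhs_nbhs; split=> //; exact: closed_openC.
move=> /nbhs_ballP[e /= e0 eX]; apply/nbhs_ballP.
(* Balls are those of the maximum norm: with [e / 2] the Euclidean length of [z0 - z] is below [e],
   while that of [y - z0] is at least [e]. *)
exists (e / 2) => /=; first by rewrite divr_gt0.
move=> z /ball_pairE[z1 z2] y Xy.
rewrite (_ : y - z = (y - z0) + (z0 - z)); last by rewrite addrA subrK.
apply: dot_perturb.
have : ~ ball z0 e y by move=> /eX.
move=> /ball_pairE/not_andP nb.
move: z1 z2; rewrite !ltr_norml => /andP[a1 a2] /andP[b1 b2].
have up : dot (z0 - z) (z0 - z) < e ^+ 2 by rewrite /dot/=; nra.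
apply: (lt_le_trans up).
case: nb => /negP; rewrite -leNgt => h.
  have : e ^+ 2 <= (z0.1 - y.1) ^+ 2.
    by rewrite -[leRHS]real_normK ?num_real// ler_sqr ?nnegrE// ltW.
  rewrite /dot/=; move: (sqr_ge0 (z0.2 - y.2)); lra.
have : e ^+ 2 <= (z0.2 - y.2) ^+ 2.
  by rewrite -[leRHS]real_normK ?num_real// ler_sqr ?nnegrE// ltW.
rewrite /dot/=; move: (sqr_ge0 (z0.1 - y.1)); lra.
Qed.

Definition chord a b (x : R) : R * R := a + x *: (b - a).
Definition seg a b : set (R * R) := chord a b @` `[0, 1]%classic.

Lemma segP a b y : seg a b y <-> exists2 x : R, 0 <= x <= 1 & y = chord a b x.
Proof.
split=> [[x] /=|[x xI ->]]; last by exists x => //=; rewrite in_itv.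
by rewrite in_itv/= => xI <-; exists x.
Qed.

Lemma chord0 a b : chord a b 0 = a.
Proof. by rewrite /chord scale0r addr0. Qed.

Lemma chord1 a b : chord a b 1 = b.
Proof. by rewrite /chord scale1r addrC subrK. Qed.

Lemma chord_rev a b x : chord a b (1 - x) = chord b a x.
Proof.
by congr pair; rewrite /GRing.scale/=/GRing.scale/=; ring.
Qed.

Lemma continuous_chord a b : continuous (chord a b).
Proof.
move=> x; apply: cvgD; first exact: cvg_cst.
by apply: cvgZ; [exact: cvg_id|exact: cvg_cst].
Qed.

Lemma seg_sym a b : seg a b = seg b a.
Proof.
apply/seteqP; split => y /segP[x x01 ->]; apply/segP; (exists (1 - x);
  [lra|by rewrite chord_rev]).
Qed.

Lemma compact_path (F : R -> R * R) s t : continuous F -> compact (F @` `[s, t]%classic).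
Proof.
move=> cF; apply: continuous_compact; last exact: segment_compact.
exact: continuous_subspaceT.
Qed.

Lemma closed_path (F : R -> R * R) s t : continuous F -> closed (F @` `[s, t]%classic).
Proof.
move=> cF; apply: compact_closed; first exact: norm_hausdorff.
exact: compact_path.
Qed.

Lemma closed_seg a b : closed (seg a b).
Proof. exact/closed_path/continuous_chord. Qed.

Lemma connected_seg a b : connected (seg a b).
Proof.
apply: connected_continuous_connected; first exact: segment_connected.
by apply: continuous_subspaceT; exact: continuous_chord.
Qed.

(** Inside [Q], the points where [w] equals [w a] and those where it differs both form open sets,
    and a segment is connected. *)
Lemma seg_const (T : Type) (Q : set (R * R)) (w : R * R -> T) a b :
  (forall z, Q z -> \forall y \near z, w y = w z) -> seg a b `<=` Q -> w a = w b.
Proof.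
move=> loc sQ.
have sa : seg a b a by apply/segP; exists 0; rewrite ?chord0// lexx ler01.
have sb : seg a b b by apply/segP; exists 1; rewrite ?chord1// lexx ler01.
pose U k := interior [set y | (w y = w a) = k].
have cover y : seg a b y -> U True y \/ U False y.
  move=> /sQ/loc h; have [e|e] := pselect (w y = w a).
    left; apply: filterS h => z /= ->; apply/propext; split => //.
  right; apply: filterS h => z /= ->; apply/propext; split => //.
have disj y : U True y -> U False y -> False.
  by move=> /interior_subset/= e1 /interior_subset/=; rewrite e1 => <-.
have : seg a b `&` U True = seg a b; first apply: (@connected_seg a b).
- exists a; split => //; case: (cover _ sa) => // /interior_subset/= h.
  by exfalso; rewrite -h.
- by exists (U True) => //; exact: open_interior.
- exists (~` U False); first by apply: open_closedC; exact: open_interior.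
  apply/seteqP; split=> y [sy Uy]; split => //; first by move=> ?; exact: (disj y).
  by case: (cover _ sy).
- by move=> /seteqP[_ /(_ _ sb)[_ /interior_subset/= h]]; symmetry; rewrite h.
Qed.

End Winding.

Section Loops.
Context {R : realType} (F : R -> R * R).
Hypothesis cF : continuous F.
Hypothesis perF : forall x, F (x + 1) = F x.
Implicit Types (a b n y z : R * R) (s t : R).

Definition arc s t : set (R * R) := F @` `[s, t]%classic.

Definition chorded s t : set (R * R) := arc s t `|` seg (F t) (F s).

(* Argument variations, i.e. 2 pi times winding numbers. *)
Definition wchorded s t z : R :=
  Var (fun x => F x - z) s t + Var (fun x => chord (F t) (F s) x - z) 0 1.

Definition wcurve s z : R := Var (fun x => F x - z) s (s + 1).

Lemma arcP s t y : arc s t y <-> exists2 x, s <= x <= t & y = F x.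
Proof.
split=> [[x] /=|[x xI ->]]; last by exists x => //=; rewrite in_itv.
by rewrite in_itv/= => xI <-; exists x.
Qed.

Lemma closed_arc s t : closed (arc s t).
Proof. exact: closed_path. Qed.

Lemma closed_chorded s t : closed (chorded s t).
Proof. by apply: closedU; [exact: closed_arc|exact: closed_seg]. Qed.

Lemma continuous_subr (g : R -> R * R) z : continuous g -> continuous (fun x => g x - z).
Proof. by move=> cg x; apply: cvgB; [exact: cg|exact: cvg_cst]. Qed.

Lemma near_notin (X : set (R * R)) z : closed X -> ~ X z -> \forall y \near z, ~ X y.
Proof.
move=> cX nX; have := open_nbhs_nbhs (conj (closed_openC cX) nX).
exact: filterS.
Qed.

Lemma wchorded_near s t z0 : s <= t -> ~ chorded s t z0 ->
  \forall z \near z0, wchorded s t z = wchorded s t z0.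
Proof.
move=> st nJ; have := near_dot (@closed_chorded s t) nJ.
apply: filterS => z Hz.
rewrite /wchorded (@Var_perturb _ (fun x => F x - z0) _ s t)//; [|exact/continuous_subr..|]; last first.
  by move=> x xst; apply: Hz; left; apply/arcP; exists x.
rewrite (@Var_perturb _ (fun x => chord (F t) (F s) x - z0) _ 0 1)//; [|exact/continuous_subr/continuous_chord..|]; last first.
  by move=> x xst; apply: Hz; right; apply/segP; exists x.
by rewrite chord0 chord1; ring.
Qed.

Lemma wcurve_near s z0 : ~ arc s (s + 1) z0 ->
  \forall z \near z0, wcurve s z = wcurve s z0.
Proof.
move=> nJ; have := near_dot (@closed_arc s (s + 1)) nJ.
apply: filterS => z Hz.
rewrite /wcurve (@Var_perturb _ (fun x => F x - z0) _ s (s + 1)) ?lerDl//; [|exact/continuous_subr..|]; last first.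
  by move=> x xst; apply: Hz; apply/arcP; exists x.
by rewrite perF addrK.
Qed.

Lemma wchorded_halfplane s t z n : s <= t ->
  (forall y, chorded s t y -> 0 < dot n (y - z)) -> wchorded s t z = 0.
Proof.
move=> st H.
rewrite /wchorded (@Var_halfplane _ _ s t n)//; [|exact/continuous_subr..|]; last first.
  by move=> x xst; apply: H; left; apply/arcP; exists x.
rewrite (@Var_halfplane _ _ 0 1 n)//; [|exact/continuous_subr/continuous_chord..|]; last first.
  by move=> x xst; apply: H; right; apply/segP; exists x.
by rewrite chord0 chord1; ring.
Qed.

Lemma wcurve_halfplane s z n :
  (forall y, arc s (s + 1) y -> 0 < dot n (y - z)) -> wcurve s z = 0.
Proof.
move=> H.
rewrite /wcurve (@Var_halfplane _ _ s (s + 1) n) ?lerDl//; [|exact/continuous_subr..|]; last first.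
  by move=> x xst; apply: H; apply/arcP; exists x.
by rewrite perF subrr.
Qed.

(** The chord is run once in each direction, so its two contributions cancel. *)
Lemma wchordedD s t z : s <= t -> t <= s + 1 -> ~ arc s (s + 1) z ->
  ~ seg (F s) (F t) z ->
  wcurve s z = wchorded s t z + wchorded t (s + 1) z.
Proof.
move=> st ts nG nE; rewrite /wcurve /wchorded perF.
rewrite (@VarD _ _ s t (s + 1))//; [|exact/continuous_subr|]; last first.
  by move=> x xst; rewrite subr_eq0; apply/eqP => e; apply: nG; apply/arcP; exists x.
rewrite (@Var_rev _ (fun x => chord (F s) (F t) x - z) (fun x => chord (F t) (F s) x - z)); first by ring.
- exact/continuous_subr/continuous_chord.
- by move=> x x01; rewrite subr_eq0; apply/eqP => e; apply: nE; apply/segP; exists x.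
- by move=> x; rewrite chord_rev.
Qed.

Lemma arc_shift s t : arc (s + 1) (t + 1) = arc s t.
Proof.
apply/seteqP; split=> y /arcP[x xst ->]; apply/arcP.
  exists (x - 1); first lra.
  by rewrite -[RHS]perF subrK.
exists (x + 1); first lra.
by rewrite perF.
Qed.

Lemma chorded_shift s t : chorded (s + 1) (t + 1) = chorded s t.
Proof. by rewrite /chorded arc_shift !perF. Qed.

Lemma wchorded_shift s t z : s <= t -> ~ arc s t z ->
  wchorded (s + 1) (t + 1) z = wchorded s t z.
Proof.
move=> st nA; rewrite /wchorded !perF Var_shift//; first exact/continuous_subr.
- by move=> x; rewrite perF.
- by move=> x xst; rewrite subr_eq0; apply/eqP => e; apply: nA; apply/arcP; exists x.
Qed.

Definition mid a b : R * R := chord a b (1 / 2).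
Definition perp a : R * R := (- a.2, a.1).

(** The closing chord runs from [F t] to [F s], so [perp (F t - F s)] points to its right. Moving
    the viewpoint off the midpoint changes the variation of the arc by endpoint angles; together
    with the variation of the chord they add up to exactly - pi or pi for every small [tau], so no
    limit is taken. *)
Lemma wchorded_jump s t : s <= t -> F s != F t -> ~ arc s t (mid (F s) (F t)) ->
  exists2 e : R, 0 < e & forall tau, 0 < tau < e ->
    let m := mid (F s) (F t) in
    let nu := perp (F t - F s) in
    wchorded s t (m + tau *: nu) = Var (fun x => F x - m) s t - pi /\
    wchorded s t (m - tau *: nu) = Var (fun x => F x - m) s t + pi.
Proof.
move=> st ab nA; set m := mid _ _; set nu := perp _.
have key (tau : R) : tau != 0 ->
    (forall y, arc s t y -> 0 < dot (y - m) (y - (m + tau *: nu))) ->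
    wchorded s t (m + tau *: nu) =
      Var (fun x => F x - m) s t - 2 * (atan (2 * tau) + atan (2 * tau)^-1).
  move=> tau0 Hd.
  have ba : F t - F s != 0 by rewrite subr_eq0 eq_sym.
  have L0 := dot_gt0 ba.
  have LE : dot (F t - F s) (F t - F s) = ((F t).1 - (F s).1) ^+ 2 + ((F t).2 - (F s).2) ^+ 2.
    by rewrite /dot/=; ring.
  rewrite LE in L0; have L0' := lt0r_neq0 L0.
  have t2 : 0 < tau ^+ 2 by rewrite exprn_even_gt0.
  rewrite /wchorded (@Var_perturb _ (fun x => F x - m) _ s t)//; [|exact/continuous_subr..|]; last first.
    by move=> x xst; apply: Hd; apply/arcP; exists x.
  rewrite (@Var_halfplane _ _ 0 1 (- tau *: nu)) ?ler01//; last first.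
  - move=> x x01.
    rewrite (_ : dot _ _ = tau ^+ 2 * (((F t).1 - (F s).1) ^+ 2 + ((F t).2 - (F s).2) ^+ 2)).
      exact: mulr_gt0.
    by rewrite /dot /nu /perp /chord /m /mid /chord/=/GRing.scale/=; field.
  - exact/continuous_subr/continuous_chord.
  rewrite chord0 chord1 /angle.
  set L := _ + _ in L0 L0'.
  have ratio (u v : R * R) k d : d != 0 -> dot u v = d -> cross u v = k * d ->
      cross u v / dot u v = k by move=> d0 -> ->; rewrite mulfK.
  have L4 : L / 4 != 0 by rewrite mulf_neq0// invr_eq0 pnatr_eq0.
  have Lt : tau ^+ 2 * L != 0 by rewrite mulf_neq0// expf_neq0.
  rewrite (ratio _ _ (- (2 * tau)) (L / 4))//; last 2 first.
  - by rewrite /L /cross /dot /nu /perp /m /mid /chord/=/GRing.scale/=; field.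
  - by rewrite /L /cross /dot /nu /perp /m /mid /chord/=/GRing.scale/=; field.
  rewrite (ratio _ _ (2 * tau) (L / 4))//; last 2 first.
  - by rewrite /L /cross /dot /nu /perp /m /mid /chord/=/GRing.scale/=; field.
  - by rewrite /L /cross /dot /nu /perp /m /mid /chord/=/GRing.scale/=; field.
  rewrite (ratio _ _ (- (2 * tau)^-1) (tau ^+ 2 * L))//; last 2 first.
  - by rewrite /L /cross /dot /nu /perp /m /mid /chord/=/GRing.scale/=; field.
  - by rewrite /L /cross /dot /nu /perp /m /mid /chord/=/GRing.scale/=; field.
  rewrite (ratio _ _ (2 * tau)^-1 (tau ^+ 2 * L))//; last 2 first.
  - by rewrite /L /cross /dot /nu /perp /m /mid /chord/=/GRing.scale/=; field.
  - by rewrite /L /cross /dot /nu /perp /m /mid /chord/=/GRing.scale/=; field.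
  by rewrite !atanN; ring.
have nd := near_dot (@closed_arc s t) nA.
have cz : m + tau *: nu @[tau --> (0 : R)] --> m.
  rewrite -[X in _ --> X]addr0 -(scale0r nu); apply: cvgD; first exact: cvg_cst.
  by apply: cvgZ; [exact: cvg_id|exact: cvg_cst].
have /nbhs_ballP[e /= e0 He] := cz _ nd.
exists e => // tau /andP[t0 te] /=.
have tt0 : 0 < 2 * tau by rewrite mulr_gt0.
split.
  rewrite key ?gt_eqF//; first by rewrite atanD_inv//; field.
  by apply: (He tau); rewrite -ball_normE /= sub0r normrN gtr0_norm.
rewrite -scaleNr key ?oppr_eq0 ?gt_eqF//.
  by rewrite mulrN invrN !atanN -opprD atanD_inv//; field.
by apply: (He (- tau)); rewrite -ball_normE /= sub0r opprK gtr0_norm.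
Qed.

End Loops.

(** * The interior of a periodic simple curve *)

Section Interior.
Context {R : realType}.
Implicit Types (a b n y z : R * R) (X : set (R * R)).

Lemma near_seg X z : closed X -> ~ X z -> \forall y \near z, seg z y `<=` ~` X.
Proof.
move=> cX nX.
have : nbhs z (~` X) by apply: open_nbhs_nbhs; split=> //; exact: closed_openC.
move=> /nbhs_ballP[e /= e0 eX]; apply/nbhs_ballP; exists e => // y /ball_pairE[y1 y2].
move=> w /segP[x /andP[x0 x1] ->]; apply: eX; apply/ball_pairE.
have aux (p q : R) : `|p - q| < e -> `|p - (p + x * (q - p))| < e.
  move=> h; rewrite opprD addNKr normrN normrM ger0_norm// distrC.
  by apply: le_lt_trans h; rewrite ler_piMl.
by split; apply: aux.
Qed.

Lemma seg_l a b : seg a b a.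
Proof. by apply/segP; exists 0; rewrite ?chord0// lexx ler01. Qed.

Lemma seg_r a b : seg a b b.
Proof. by apply/segP; exists 1; rewrite ?chord1// lexx ler01. Qed.

Lemma component_seg X a b : seg a b `<=` ~` X ->
  connected_component (~` X) a b.
Proof.
by move=> sX; exists (seg a b); [split|]; [exact: seg_l|exact: sX|exact: connected_seg|exact: seg_r].
Qed.

Lemma component_open X z : closed X -> open (connected_component (~` X) z).
Proof.
move=> cX; rewrite openE => y zy; have ny := connected_component_sub zy.
apply: filterS (near_seg cX ny) => w /component_seg yw.
exact: connected_component_trans zy yw.
Qed.

(** A limit point off [X] is joined to nearby points by segments off [X], hence to some point of the
    component. *)
Lemma component_closure X z : closed X ->
  closure (connected_component (~` X) z) `<=` connected_component (~` X) z `|` X.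
Proof.
move=> cX y cy; have [|ny] := pselect (X y); first by right.
left; have [w [zw /component_seg yw]] := cy _ (near_seg cX ny).
by apply: (connected_component_trans zw); exact: connected_component_sym.
Qed.

Lemma Int_seg X a b : Int X a -> seg a b `<=` ~` X -> Int X b.
Proof.
move=> [na ba] sX; split; first by apply: sX; exact: seg_r.
by rewrite -(same_connected_component (component_seg sX)).
Qed.

Lemma open_edisk (c : R * R) (r : R) : open (edisk c r).
Proof.
rewrite openE => z; rewrite /edisk/= => zr.
have cs : sqdist c y @[y --> z] --> sqdist c z.
  have aux (p : R) (f : R * R -> R) l : f @ z --> l -> (p - f y) ^+ 2 @[y --> z] --> (p - l) ^+ 2.
    move=> fl; apply: cvgM; apply: cvgB => //; exact: cvg_cst.
  by apply: cvgD; apply: aux; [exact: cvg_fst|exact: cvg_snd].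
exact: (cvgr_lt _ cs).
Qed.

Lemma sqdistE a b : sqdist a b = dot (a - b) (a - b).
Proof. by rewrite /sqdist /dot/=; ring. Qed.

(** Stewart's identity; its last term gives the convexity of disks. *)
Lemma chord_sqdist (c : R * R) a b x : sqdist c (chord a b x) =
  (1 - x) * sqdist c a + x * sqdist c b - x * (1 - x) * sqdist a b.
Proof. by rewrite /sqdist /chord/=/GRing.scale/=; ring. Qed.

Lemma sqdist_ge0 a b : 0 <= sqdist a b.
Proof. by rewrite sqdistE dot_ge0. Qed.

Lemma convex_lt (A B C x : R) : 0 <= x <= 1 -> A < C -> B < C -> (1 - x) * A + x * B < C.
Proof.
move=> /andP[x0 x1] hAC hBC; apply: (@le_lt_trans _ _ (Num.max A B)); last by rewrite gt_max hAC.
have hA : A <= Num.max A B by rewrite le_max lexx.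
have hB : B <= Num.max A B by rewrite le_max lexx orbT.
nra.
Qed.

Lemma seg_edisk (c : R * R) (r : R) a b : sqdist c a < r ^+ 2 -> sqdist c b < r ^+ 2 ->
  seg a b `<=` edisk c r.
Proof.
move=> ha hb y /segP[x /[dup] x01 /andP[x0 x1] ->]; rewrite /edisk/= chord_sqdist.
have : 0 <= x * (1 - x) * sqdist a b by rewrite !mulr_ge0 ?subr_ge0 ?sqdist_ge0.
have := convex_lt x01 ha hb; lra.
Qed.

Lemma edisk_Int X (c z : R * R) (r : R) : edisk c r z -> Int X z -> edisk c r `<=` ~` X ->
  edisk c r `<=` Int X.
Proof.
move=> Dz Iz DX y Dy; apply: Int_seg Iz _.
by apply: subset_trans DX; exact: seg_edisk.
Qed.

End Interior.

(** * Winding numbers and non-separation for a periodic simple curve *)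

Section PeriodicCurve.
Context {R : realType} (F : R -> R * R).
Hypothesis cF : continuous F.
Hypothesis perF : forall x, F (x + 1) = F x.
Hypothesis injF : forall x y, `|x - y| < 1 -> F x = F y -> x = y.
Implicit Types (a b n y z : R * R) (s t u : R).

Lemma range_arc s : range F = arc F s (s + 1).
Proof.
have perN (n : nat) x : F (x + n%:R) = F x.
  by elim: n => [|n IH]; rewrite ?addr0// -natr1 addrA perF.
have perZ (n : int) x : F (x + n%:~R) = F x.
  case: n => n; first exact: perN.
  by rewrite NegzE mulrNz -(perN n.+1 (x - _)) subrK.
apply/seteqP; split => y; last by move=> /arcP[x _ ->]; exists x.
move=> [x _ <-]; apply/arcP; exists (x - (Num.floor (x - s))%:~R).
  have := floor_le_tmp (x - s); have := floorD1_gt (x - s).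
  rewrite intrD; lra.
by rewrite -mulrNz perZ.
Qed.

Lemma range_arc_lt s y : range F y -> exists2 x, s <= x < s + 1 & y = F x.
Proof.
rewrite (range_arc s) => /arcP[x /andP[sx xs] ->].
move: xs; rewrite le_eqVlt => /orP[/eqP->|xs]; last by exists x => //; rewrite sx.
by exists s; [rewrite lexx ltrDl ltr01|rewrite perF].
Qed.

Lemma closed_range : closed (range F).
Proof. by rewrite (range_arc 0); exact: closed_arc. Qed.

Lemma range_bounded : exists2 M : R, 0 < M & forall x, dot (F x) (F x) < M.
Proof.
have c : {within `[0 : R, 1]%classic, continuous (fun x => dot (F x) (F x))}.
  by apply: continuous_subspaceT => x; apply: cvg_dot; exact: cF.
have [x0 _ Hx] := EVT_max (@ler01 R) c.
exists (dot (F x0) (F x0) + 1); first by rewrite ltr_pwDr// dot_ge0.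
move=> x; have : range F (F x) by exists x.
move=> /(@range_arc_lt 0)[u /andP[u0 u1] ->]; rewrite ltr_pwDr// Hx// in_itv/= u0.
by rewrite ltW// -[ltRHS]add0r.
Qed.

Lemma far_dot (M : R) y z : dot y y < M -> M <= dot z z -> 0 < dot (- z) (y - z).
Proof.
move=> yM Mz; rewrite (addrC y) dot_perturb// (_ : dot (- z) (- z) = dot z z).
  exact: lt_le_trans Mz.
by rewrite /dot/=; ring.
Qed.

Lemma wcurve_far (M : R) s z : (forall x, dot (F x) (F x) < M) -> M <= dot z z ->
  wcurve F s z = 0.
Proof.
move=> HM Mz; apply: (wcurve_halfplane cF perF (n := - z)) => y /arcP[x _ ->].
exact: far_dot (HM x) Mz.
Qed.

Lemma wchorded_far (M : R) s t z : s <= t -> (forall x, dot (F x) (F x) < M) ->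
  M <= dot z z -> wchorded F s t z = 0.
Proof.
move=> st HM Mz; apply: (wchorded_halfplane cF st (n := - z)) => y [/arcP[x _ ->]|].
  exact: far_dot (HM x) Mz.
move=> /segP[x /[dup] x01 /andP[x0 x1] ->]; apply: far_dot Mz.
have dE v : dot v v = sqdist 0 v by rewrite /dot /sqdist/=; ring.
have := convex_lt x01 (HM t) (HM s); rewrite !dE chord_sqdist.
have : 0 <= x * (1 - x) * sqdist (F t) (F s) by rewrite !mulr_ge0 ?subr_ge0 ?sqdist_ge0.
lra.
Qed.

(** The squared distance is at most twice the sum of the squared norms, so below [4 * M]; the radius
    [4 * M + 1] has a larger square and needs no root. *)
Lemma edisk_far (M : R) y z : dot y y < M -> dot z z < M -> edisk y (4 * M + 1) z.
Proof.
rewrite /edisk/= /sqdist /dot.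
set p := y.1; set q := y.2; set v := z.1; set w := z.2 => h1 h2.
have := sqr_ge0 (p + v); have := sqr_ge0 (q + w).
have := sqr_ge0 p; have := sqr_ge0 q; nra.
Qed.

Lemma bounded_edisk (W : set (R * R)) z : bounded_plane W -> W z ->
  exists2 M : R, 0 < M & W `<=` edisk z M.
Proof.
move=> [M HM] Wz.
have B y : W y -> dot y y < 2 * M ^+ 2 + 1.
  move=> /HM[]; rewrite !ler_norml /dot => /andP[? ?] /andP[? ?]; nra.
exists (4 * (2 * M ^+ 2 + 1) + 1); first by have := sqr_ge0 M; lra.
by move=> y Wy; apply: edisk_far; exact: B.
Qed.

(** Were the variation 0, the lift would agree at [s] and [s + 1], the only distinct parameters of
    the period with a common image, and [borsuk] would apply to the component of [z]. *)
Lemma wcurve_Int s z : Int (range F) z -> wcurve F s z <> 0.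
Proof.
move=> [nz bz] w0.
have Fz x : F x - z != 0 by rewrite subr_eq0; apply/eqP => e; apply: nz; exists x.
have ss : s <= s + 1 by rewrite lerDl.
have [th L] := lift_path ss (@continuous_subr _ F z cF) (fun x _ => Fz x).
have e : th (s + 1) = th s.
  by apply/eqP; rewrite -subr_eq0 -(VarE ss L); apply/eqP.
have Wz : connected_component (~` range F) z z by apply: connected_component_refl.
have [M M0 WM] := bounded_edisk bz Wz.
have clW : closure (connected_component (~` range F) z) `<=`
    connected_component (~` range F) z `|` arc F s (s + 1).
  by rewrite -range_arc; exact: component_closure closed_range.
have oW : open (connected_component (~` range F) z) by exact: component_open closed_range.
apply: (borsuk ss cF L _ oW Wz M0 WM clW).
have key u v : s <= u -> u <= v -> v <= s + 1 -> F u = F v -> th u = th v.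
  move=> su uv vs Fuv; have [h|h] := ltP `|u - v| 1; first by rewrite (injF h Fuv).
  have -> : u = s by move: h; rewrite ler0_norm ?subr_le0//; lra.
  by have -> : v = s + 1 by move: h; rewrite ler0_norm ?subr_le0//; lra.
move=> u v /andP[su us] /andP[sv vs] Fuv.
have [uv|/ltW vu] := leP u v; first exact: key.
by symmetry; apply: key.
Qed.

Lemma Int_bounded (M : R) z : (forall x, dot (F x) (F x) < M) -> Int (range F) z ->
  dot z z < M.
Proof.
move=> HM Iz; rewrite ltNge; apply/negP => h.
exact: (wcurve_Int (s := 0) Iz (wcurve_far _ HM h)).
Qed.

(** Over less than a period [F] is injective, so any lift is constant on fibres and [borsuk]
    applies. *)
Lemma arc_nonseparating s t (M : R) z (W : set (R * R)) : s <= t -> t < s + 1 ->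
  ~ arc F s t z -> open W -> W z -> 0 < M -> W `<=` edisk z M ->
  closure W `<=` W `|` arc F s t -> False.
Proof.
move=> st ts nz.
have Fz x : s <= x <= t -> F x - z != 0.
  by move=> xst; rewrite subr_eq0; apply/eqP => e; apply: nz; apply/arcP; exists x.
have [th L] := lift_path st (@continuous_subr _ F z cF) Fz.
apply: (borsuk st cF L) => u v ust vst Fuv; congr th; apply: injF => //.
rewrite ltr_norml; lra.
Qed.

(** Otherwise all points near [F u] off the curve have nonzero winding number. Adding the piece of
    the curve near [F u] to the set of nonzero winding number gives a bounded open set whose
    boundary lies on the remaining arc [A], and an arc does not separate. *)
Lemma exterior_adherent s u (P : R * R -> Prop) : (\forall y \near F u, P y) ->
  exists y, [/\ P y, ~ range F y & wcurve F s y = 0].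
Proof.
move=> nP; apply: contrapT => H.
have {}H y : P y -> ~ range F y -> wcurve F s y <> 0.
  by move=> Py ny e; apply: H; exists y.
have oB : open (interior P) by exact: open_interior.
have BP : interior P `<=` P by exact: interior_subset.
have Bu : interior P (F u) by exact: nP.
move: oB BP Bu; set B := interior P => oB BP Bu.
have [d /= d0 Hd] : exists2 d : R, 0 < d & forall x, `|u - x| < d -> B (F x).
  have : \forall x \near u, B (F x) by apply: cF; apply: open_nbhs_nbhs.
  move=> /nbhs_ballP[d /= d0 Hd]; exists d => // x ux; exact: Hd.
(* Parameters within [e] of [u] are mapped into [B]; the bound 1/4 keeps [u + e] below
   [u + 1 - e]. *)
pose e := Num.min (d / 2) (1 / 4 : R).
have e0 : 0 < e by rewrite lt_min !divr_gt0.
have ed : e < d by rewrite gt_min ltr_pdivrMr// ltr_pMr// ltr1n.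
have e4 : e <= 1 / 4 by rewrite ge_min lexx orbT.
pose A := arc F (u + e) (u + 1 - e).
have nA : ~ A (F u).
  move=> /arcP[x xI Fux]; have /injF/(_ Fux) : `|u - x| < 1 by rewrite ltr_norml; lra.
  lra.
pose V := [set y | ~ range F y /\ wcurve F s y <> 0].
pose W := V `|` (B `&` ~` A).
have [M M0 HM] := range_bounded.
have VM y : V y -> dot y y < M.
  move=> [_ wy]; rewrite ltNge; apply/negP => h; apply: wy; exact: wcurve_far h.
have WM y : W y -> dot y y < M.
  move=> [/VM//|[By _]]; have [[x _ <-]//|ny] := pselect (range F y).
  by apply: VM; split=> //; apply: H => //; exact: BP.
have nV y : ~ range F y -> \forall z \near y, ~ range F z /\ wcurve F s z = wcurve F s y.
  move=> ny; apply: filterI; first exact: near_notin closed_range ny.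
  by apply: wcurve_near => //; rewrite -range_arc.
apply: (@arc_nonseparating (u + e) (u + 1 - e) (4 * M + 1) (F u) W) => //.
- lra.
- lra.
- apply: openU.
    rewrite openE => y [ny wy]; apply: filterS (nV y ny) => z [nz wz]; split=> //; by rewrite wz.
  by apply: openI => //; apply: closed_openC; exact: closed_arc.
- by right.
- by rewrite ltr_wpDl// mulr_ge0// ltW.
- by move=> y Wy; apply: edisk_far; [exact: HM|exact: WM].
move=> y cy; have [ry|ny] := pselect (range F y).
  have [Ay|nAy] := pselect (A y); first by right.
  left; right; split=> //.
  have [x xI yx] := range_arc_lt (u - e) ry.
  rewrite yx; apply: Hd; rewrite ltr_norml.
  have [|h] := leP x (u + e); first lra.
  by exfalso; apply: nAy; apply/arcP; exists x => //; lra.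
left; left; split=> //.
have [z [Wz [nz wz]]] := cy _ (nV y ny).
rewrite -wz; case: Wz => [[]//|[Bz _]]; apply: H => //; exact: BP.
Qed.

End PeriodicCurve.

(** * Splitting the curve along a chord of an inscribed disk *)

Section ChordSplit.
Context {R : realType} (F : R -> R * R).
Hypothesis cF : continuous F.
Hypothesis perF : forall x, F (x + 1) = F x.
Hypothesis injF : forall x y, `|x - y| < 1 -> F x = F y -> x = y.
Implicit Types (a b c n y z : R * R) (r s t u : R).

Definition inscribed c r s t : Prop :=
  [/\ 0 < r, edisk c r `<=` Int (range F), ecircle c r (F s) & ecircle c r (F t)].

Lemma inscribed_shift c r s t : inscribed c r s t -> inscribed c r t (s + 1).
Proof. by case=> *; split => //; rewrite /ecircle/= perF. Qed.

Lemma neqF s t : s < t -> t < s + 1 -> F s != F t.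
Proof.
move=> st ts; apply/eqP => /injF h; have : s = t by apply: h; rewrite ltr_norml; lra.
lra.
Qed.

Lemma sqdist_gt0 a b : a != b -> 0 < sqdist a b.
Proof. by rewrite sqdistE -subr_eq0; exact: dot_gt0. Qed.

(** The power of the chord point with respect to the circle is - x (1 - x) times the squared length
    of the chord. *)
Lemma chord_edisk c r a b x : ecircle c r a -> ecircle c r b -> a != b ->
  edisk c r (chord a b x) <-> 0 < x < 1.
Proof.
rewrite /ecircle/edisk/= chord_sqdist => -> -> /sqdist_gt0 ab.
have -> : (1 - x) * r ^+ 2 + x * r ^+ 2 - x * (1 - x) * sqdist a b =
  r ^+ 2 - (x * (1 - x)) * sqdist a b by ring.
rewrite gtrBl pmulr_lgt0//; split; nra.
Qed.

Lemma seg_inscribed c r s t y : inscribed c r s t -> F s != F t ->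
  seg (F s) (F t) y -> [\/ y = F s, y = F t | edisk c r y].
Proof.
move=> [r0 D cs ct] st /segP[x /andP[]]; rewrite !le_eqVlt.
move=> /orP[/eqP<- _ ->|x0]; first by rewrite chord0; constructor 1.
move=> /orP[/eqP-> ->|x1 ->]; first by rewrite chord1; constructor 2.
by constructor 3; apply/chord_edisk => //; apply/andP.
Qed.

Lemma mid_edisk c r s t : inscribed c r s t -> F s != F t -> edisk c r (mid (F s) (F t)).
Proof.
move=> [r0 D cs ct] st; apply/chord_edisk => //; lra.
Qed.

Lemma inscribed_disjoint c r s t x : inscribed c r s t -> ~ edisk c r (F x).
Proof. by move=> [_ D _ _] /D[+ _]; apply; exists x. Qed.

Section Fixed.
Variables (s t : R).
Hypotheses (st : s < t) (ts : t < s + 1).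
Variables (c : R * R) (r : R).
Hypothesis ins : inscribed c r s t.

Let a := F s.
Let b := F t.
Let m := mid a b.
Let nu := perp (b - a).
Let alpha := Var (fun x => F x - m) s t.
Let ab : a != b := neqF st ts.

Lemma mid_notin : ~ arc F s t m.
Proof.
by move=> /arcP[x _ e]; apply: (@inscribed_disjoint c r s t x ins); rewrite -e; exact: mid_edisk.
Qed.

Lemma dot_nu_gt0 : 0 < dot nu nu.
Proof.
rewrite (_ : dot nu nu = dot (b - a) (b - a)); last by rewrite /nu /dot/=; ring.
by apply: dot_gt0; rewrite subr_eq0 eq_sym.
Qed.

Lemma side_notin y : edisk c r y -> dot (y - m) nu != 0 -> ~ chorded F s t y.
Proof.
move=> Dy side [/arcP[x _ e]|/segP[x _ e]].
  by apply: (@inscribed_disjoint c r s t x ins); rewrite -e.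
move/eqP: side; apply; rewrite e /dot /chord /m /nu /mid /chord/=/GRing.scale/=/GRing.scale/=.
by rewrite /a /b; field.
Qed.

Lemma mid_offset (l : R * R) : exists2 d : R, 0 < d &
  forall tau, 0 < tau < d -> edisk c r (m + tau *: l).
Proof.
have cz : m + tau *: l @[tau --> (0 : R)] --> m.
  rewrite -[X in _ --> X]addr0 -(scale0r l); apply: cvgD; first exact: cvg_cst.
  by apply: cvgZ; [exact: cvg_id|exact: cvg_cst].
have nD : nbhs m (edisk c r).
  by apply: open_nbhs_nbhs; split; [exact: open_edisk|exact: mid_edisk].
have /nbhs_ballP[d /= d0 Hd] := cz _ nD.
exists d => // tau /andP[t0 td]; apply: Hd.
by rewrite -ball_normE /= sub0r normrN gtr0_norm.
Qed.

(** The half of the disk on one side of the chord is convex and misses the loop, so [y] is joined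
    there to a point near [m] where [wchorded_jump] gives the value. *)
Lemma side_value (sg : R) y : (sg = 1) \/ (sg = -1) -> edisk c r y ->
  0 < sg * dot (y - m) nu -> wchorded F s t y = alpha - sg * pi.
Proof.
move=> sg1 Dy side.
have [e e0 He] := wchorded_jump cF (ltW st) ab mid_notin.
have sq1 : sg ^+ 2 = 1 by case: sg1 => ->; ring.
have [d d0 Hd] := mid_offset (sg *: nu).
pose tau := Num.min e d / 2.
have me : Num.min e d <= e by rewrite ge_min lexx.
have md : Num.min e d <= d by rewrite ge_min lexx orbT.
have m0 : 0 < Num.min e d by rewrite lt_min e0.
have [tau0 taue taud] : [/\ 0 < tau, tau < e & tau < d] by rewrite /tau; split; lra.
have Dm : edisk c r (m + tau *: (sg *: nu)) by apply: Hd; rewrite tau0.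
have nu0 := dot_nu_gt0.
have -> : wchorded F s t y = wchorded F s t (m + tau *: (sg *: nu)).
  apply: (@seg_const _ _ (~` chorded F s t)).
    by move=> z nz; apply: wchorded_near => //; exact: ltW.
  move=> z yz; have Dz : edisk c r z by exact: seg_edisk yz.
  have sz : 0 < sg * dot (z - m) nu.
    have [x /andP[x0 x1] ->] := (segP _ _ _).1 yz.
    rewrite (_ : sg * _ = (1 - x) * (sg * dot (y - m) nu) + x * (tau * (sg ^+ 2 * dot nu nu))).
      have h1 : 0 < tau * (sg ^+ 2 * dot nu nu) by rewrite sq1 mul1r mulr_gt0.
      have [->|xn0] := eqVneq x 0; first by rewrite subr0 mul1r mul0r addr0.
      have xp : 0 < x by rewrite lt_neqAle eq_sym xn0.
      apply: ltr_wpDl; last exact: mulr_gt0.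
      by rewrite mulr_ge0 ?subr_ge0// ltW.
    by rewrite /dot /chord/=/GRing.scale/=/GRing.scale/=; ring.
  apply: side_notin => //; apply: contraTneq sz => e'.
  by rewrite e' mulr0 ltxx.
have [|h1 h2] := He tau; first by rewrite tau0.
case: sg1 => ->; first by rewrite scale1r mul1r h1.
by rewrite scaleN1r scalerN h2 mulN1r opprK.
Qed.

Lemma edisk_value y : edisk c r y -> ~ chorded F s t y ->
  wchorded F s t y = alpha - pi \/ wchorded F s t y = alpha + pi.
Proof.
move=> Dy nJ; have [h|h|h] := ltgtP (dot (y - m) nu) 0.
- right; rewrite (side_value (sg := -1)) ?mulN1r ?opprK ?oppr_gt0//.
  by right.
- by left; rewrite (side_value (sg := 1)) ?mul1r//; left.
(* The remaining points lie on the line of the chord, and inside the disk this line is the open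
   chord. *)
exfalso; apply: nJ; right; rewrite seg_sym.
have L0 : 0 < dot (b - a) (b - a) by apply: dot_gt0; rewrite subr_eq0 eq_sym.
pose x := dot (y - a) (b - a) / dot (b - a) (b - a).
have cr : cross (b - a) (y - a) = 0.
  by rewrite -h /cross /dot /nu /m /mid /chord/=/GRing.scale/=/GRing.scale/=; field.
have yE : y = chord a b x.
  have L0' := lt0r_neq0 L0.
  have e1 : (y.1 - a.1) * dot (b - a) (b - a) = dot (y - a) (b - a) * (b.1 - a.1).
    rewrite -[RHS]subr0 -(mul0r (b.2 - a.2)) -cr /dot /cross/=; ring.
  have e2 : (y.2 - a.2) * dot (b - a) (b - a) = dot (y - a) (b - a) * (b.2 - a.2).
    rewrite -[LHS]subr0 -(mul0r (b.1 - a.1)) -cr /dot /cross/=; ring.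
  rewrite [LHS]surjective_pairing; congr pair.
    rewrite -[RHS]/(a.1 + x * (b.1 - a.1)) /x mulrAC -e1 mulfK//; ring.
  rewrite -[RHS]/(a.2 + x * (b.2 - a.2)) /x mulrAC -e2 mulfK//; ring.
case: ins => _ _ cs ct.
move: Dy; rewrite yE => /(chord_edisk _ cs ct ab) x01.
by apply/segP; exists x => //; lra.
Qed.

Lemma chord_endpoint y : seg b a y -> ~ arc F s t y -> edisk c r y.
Proof.
rewrite seg_sym => /(seg_inscribed ins ab)[-> []|-> []|//]; apply/arcP.
  by exists s => //; rewrite lexx ltW.
by exists t => //; rewrite lexx ltW.
Qed.

(* The chord crosses between the two values alpha +- pi, and a level set of the
   winding number avoiding both would be bounded by the arc alone. *)
Lemma chorded_values (Q : R -> Prop) : ~ Q 0 -> (Q (alpha - pi) <-> Q (alpha + pi)) ->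
  forall y, ~ chorded F s t y -> ~ Q (wchorded F s t y).
Proof.
move=> Q0 Qpm y0 nJ0 Qy0.
have cJ := @closed_chorded _ F cF s t.
pose V := [set y | ~ chorded F s t y /\ Q (wchorded F s t y)].
(* If [Q] holds at both values, the whole disk is added, which makes the open chord interior to [W];
   if it fails at both, [V] keeps away from the open chord. In both cases the boundary of [W] lies
   on the arc. *)
pose W := V `|` [set y | Q (alpha + pi) /\ edisk c r y].
have [M M0 HM] := range_bounded cF perF.
have DM y : edisk c r y -> dot y y < M.
  by case: ins => _ D _ _ /D; exact: Int_bounded.
have WM y : W y -> dot y y < M.
  move=> [[_ Qy]|[_ /DM//]]; rewrite ltNge; apply/negP => h; apply: Q0.
  by rewrite -(wchorded_far cF (ltW st) HM h).
have nV y : ~ chorded F s t y ->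
    \forall z \near y, ~ chorded F s t z /\ wchorded F s t z = wchorded F s t y.
  move=> ny; apply: filterI; first exact: near_notin ny.
  by apply: wchorded_near => //; exact: ltW.
have Qd y : edisk c r y -> ~ chorded F s t y ->
    Q (wchorded F s t y) <-> Q (alpha + pi).
  by move=> Dy /(edisk_value Dy)[->|->].
have Wy0 : W y0 by left.
apply: (@arc_nonseparating _ F cF injF s t (4 * M + 1) y0 W) => //.
- exact: ltW.
- by move=> h; apply: nJ0; left.
- apply: openU.
    rewrite openE => y [ny Qy]; apply: filterS (nV y ny) => z [nz wz]; split=> //; by rewrite wz.
  have [Qp|nQ] := pselect (Q (alpha + pi)).
    rewrite (_ : [set y | _] = edisk c r); first exact: open_edisk.
    by apply/seteqP; split=> y /=; [case|].
  rewrite (_ : [set y | _] = set0); first exact: open0.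
  by apply/seteqP; split=> y //= -[].
- by rewrite ltr_wpDl// mulr_ge0// ltW.
- by move=> y Wy; apply: edisk_far; exact: WM.
move=> y cy; have [Ay|nA] := pselect (arc F s t y); first by right.
left; have [/chord_endpoint/(_ nA) Dy|nS] := pselect (seg b a y).
  right; split => //.
  have nD : nbhs y (edisk c r) by apply: open_nbhs_nbhs; split=> //; exact: open_edisk.
  by have [z [[[nz Qz]|[//]] Dz]] := cy _ nD; apply/(Qd _ Dz nz).
have nJ : ~ chorded F s t y by case.
have [z [Wz [nz wz]]] := cy _ (nV y nJ).
left; split=> //; rewrite -wz; case: Wz => [[]//|[Qp Dz]].
exact/(Qd _ Dz nz).
Qed.

(** One side of the chord has winding number 0: otherwise [chorded_values], applied to being
    nonzero, is contradicted by a disk point off the chord. *)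
Lemma chorded_pm : alpha = pi \/ alpha = - pi.
Proof.
apply: contrapT => /not_orP[n1 n2].
have [d d0 Hd] := mid_offset nu.
have t0 : 0 < d / 2 by rewrite divr_gt0.
have Dy : edisk c r (m + (d / 2) *: nu) by apply: Hd; lra.
have side : 0 < dot (m + (d / 2) *: nu - m) nu.
  rewrite (_ : dot _ _ = d / 2 * dot nu nu); last by rewrite /dot/=/GRing.scale/=; ring.
  by rewrite mulr_gt0// dot_nu_gt0.
apply: (@chorded_values (fun k => k <> 0) _ _ _ (side_notin Dy (lt0r_neq0 side))) => //.
  by split=> _; [move/eqP; rewrite addr_eq0 => /eqP|move/eqP; rewrite subr_eq0 => /eqP].
rewrite (@side_value 1)//; [|by left|by rewrite mul1r].
by rewrite mul1r => /eqP; rewrite subr_eq0 => /eqP.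
Qed.

Lemma chorded_range y : ~ chorded F s t y ->
  [\/ wchorded F s t y = 0, wchorded F s t y = alpha - pi | wchorded F s t y = alpha + pi].
Proof.
move=> ny; apply: contrapT => n.
apply: (@chorded_values (fun k => [/\ k <> 0, k <> alpha - pi & k <> alpha + pi]) _ _ y ny) => //.
- by case.
- by split=> -[].
by split=> e; apply: n; rewrite e; [constructor 1|constructor 2|constructor 3].
Qed.

End Fixed.

Lemma mid_sym a b : mid a b = mid b a.
Proof.
by rewrite /mid -(chord_rev b a); congr chord; field.
Qed.

(** The variations of the two arcs seen from the midpoint of the chord are pi or - pi each, and
    their sum is nonzero because the midpoint is interior; so they have the same sign. Hence the two
    chorded winding numbers never have opposite signs. They add up to 0 at a point of winding number
    0 close to [F u], so both vanish there. *)
Lemma opposite_exterior c r s t u : s < t -> t < s + 1 -> inscribed c r s t ->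
  s < u < t ->
  ~ chorded F t (s + 1) (F u) /\ wchorded F t (s + 1) (F u) = 0.
Proof.
move=> st ts ins /andP[su ut].
have st' : t < s + 1 := ts; have ts' : s + 1 < t + 1 by rewrite ltrD2r.
have ins' := inscribed_shift ins.
have ab := neqF st ts.
have nu : ~ chorded F t (s + 1) (F u).
  move=> [/arcP[x /andP[tx xs] /injF e]|].
    have : u = x by apply: e; rewrite ltr_norml; lra.
    lra.
  rewrite perF => /(seg_inscribed ins ab)[/injF e|/injF e|].
  - have : u = s by apply: e; rewrite ltr_norml; lra.
    lra.
  - have : u = t by apply: e; rewrite ltr_norml; lra.
    lra.
  - exact: inscribed_disjoint ins.
split=> //.
have mD := mid_edisk ins ab; case: (ins) => _ DI _ _.
have mI := DI _ mD.
have := wcurve_Int cF perF injF (s := s) mI.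
have nm x : F x - mid (F s) (F t) != 0.
  by rewrite subr_eq0; apply/eqP => e; apply: mI.1; exists x.
rewrite /wcurve (@VarD _ _ s t (s + 1)) ?ltW//; last exact: continuous_subr.
have := chorded_pm st ts ins; have := chorded_pm ts ts' ins'.
rewrite perF (mid_sym (F t)) => pmb pma ab0.
have nr : \forall y \near F u, ~ chorded F t (s + 1) y /\
    wchorded F t (s + 1) y = wchorded F t (s + 1) (F u).
  apply: filterI; first by apply: near_notin nu; exact: closed_chorded.
  by apply: wchorded_near => //; exact: ltW.
have [y [[ny wy] nG y0]] := exterior_adherent cF perF injF s nr.
have nS : ~ seg (F s) (F t) y by move=> sy; apply: ny; right; rewrite perF.
have nJ : ~ chorded F s t y.
  case; last by rewrite seg_sym.
  by move=> /arcP[x _ e]; apply: nG; exists x.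
have nA : ~ arc F s (s + 1) y by rewrite -range_arc.
move: y0; rewrite (wchordedD cF perF (ltW st) (ltW ts) nA nS) wy.
have := chorded_range st ts ins nJ; have := chorded_range ts ts' ins' nu.
rewrite perF (mid_sym (F t)); have := @pi_gt0 R.
by move=> p0 [] -> [] -> ; move: ab0; case: pma => ->; case: pmb => ->; lra.
Qed.

End ChordSplit.

(** * Inscribed disks *)

Section Contacts.
Context {R : realType} (F : R -> R * R).
Hypothesis cF : continuous F.
Hypothesis perF : forall x, F (x + 1) = F x.
Hypothesis injF : forall x y, `|x - y| < 1 -> F x = F y -> x = y.
Hypothesis bcc : bounded_convex_curvature (range F).
Hypothesis no_disk : ~ exists c : R * R, edisk c 1 `<=` Int (range F).
Implicit Types (a b c n y z : R * R) (r s t u : R).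

(* kappa v is the curvature of the circle through F v tangent to U_x at x = F u,
   so the disk touching at x can grow until its curvature is max kappa. *)
Lemma second_contact u : exists v c r, inscribed F c r u v /\ F v != F u.
Proof.
pose x := F u.
have [|c0 [c0x [e e0 De]]] := bcc (x := x); first by exists u.
pose n := c0 - x.
have n1 : dot n n = 1 by rewrite -sqdistE; move: c0x; rewrite /ecircle/= expr1n.
have dE r y : sqdist (x + r *: n) y = sqdist x y - 2 * r * dot n (y - x) + r ^+ 2.
  have -> : r ^+ 2 = r ^+ 2 * dot n n by rewrite n1 mulr1.
  rewrite /sqdist /dot/=/GRing.scale/=/GRing.scale/=; ring.
have c0E : c0 = x + 1 *: n by rewrite scale1r /n addrC subrK.
have near_x y : sqdist x y < e ^+ 2 -> sqdist c0 y < 1 -> Int (range F) y.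
  by move=> h1 h2; apply: De; split => //; rewrite /edisk/= expr1n.
(* Within distance [e] of [x] the tangent disk is covered by the unit disk of the curvature
   condition; the last premise keeps the curve points farther away out of it. *)
have grow r : 0 < r -> r <= 1 ->
    (forall v, 0 <= v <= 1 -> e ^+ 2 <= sqdist x (F v) ->
      2 * r * dot n (F v - x) <= sqdist x (F v)) ->
    edisk (x + r *: n) r `<=` Int (range F).
  move=> r0 r1 H.
  have sub y : sqdist (x + r *: n) y < r ^+ 2 -> sqdist c0 y < 1.
    by rewrite c0E !dE expr1n; have := sqdist_ge0 x y; nra.
  (* The point [x + d *: n] lies in the tangent disk and is already known to be interior, as
     [edisk_Int] requires. *)
  pose d := Num.min e r / 2.
  have me : Num.min e r <= e by rewrite ge_min lexx.
  have mr : Num.min e r <= r by rewrite ge_min lexx orbT.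
  have m0 : 0 < Num.min e r by rewrite lt_min e0.
  have [d0 de dr] : [/\ 0 < d, d < e & d < r] by rewrite /d; split; lra.
  have dn : dot n (x + d *: n - x) = d.
    by rewrite -[RHS]mulr1 -[X in _ = _ * X]n1 /dot/=/GRing.scale/=/GRing.scale/=; ring.
  have xd : sqdist x (x + d *: n) = d ^+ 2.
    by rewrite -[RHS]mulr1 -[X in _ = _ * X]n1 /sqdist /dot/=/GRing.scale/=/GRing.scale/=; ring.
  have Dd : edisk (x + r *: n) r (x + d *: n) by rewrite /edisk/= dE dn xd; nra.
  apply: (edisk_Int Dd); first by apply: near_x; [rewrite xd; nra|exact: sub Dd].
  move=> y Dy [w _ wy].
  have [v /andP[v0 v1] yv] : exists2 v, 0 <= v < 0 + 1 & y = F v.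
    by apply: (range_arc_lt perF); exists w.
  have [h|h] := ltP (sqdist x y) (e ^+ 2).
    by apply: (near_x y h (sub y Dy)).1; exists w.
  have := H v; rewrite -yv v0/= => /(_ _ h).
  move: Dy; rewrite /edisk/= dE => Dy /(_ _); lra.
pose T := `[0, 1]%classic `&` [set v | e ^+ 2 <= sqdist x (F v)].
have cs : continuous (fun v => sqdist x (F v)).
  move=> v; rewrite (_ : (fun v => _) = fun v => dot (x - F v) (x - F v)); last first.
    by apply/funext => w; rewrite sqdistE.
  by apply: cvg_dot; apply: cvgB; (try exact: cvg_cst); exact: cF.
have cT : compact T.
  apply: compact_closedI; first exact: segment_compact.
  rewrite (_ : [set v | _] = (fun v => sqdist x (F v)) @^-1` [set k | e ^+ 2 <= k])//.
  by apply: closed_comp; [move=> v _; exact: cs|exact: closed_ge].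
pose kappa v := 2 * dot n (F v - x) / sqdist x (F v).
have Tpos v : T v -> 0 < sqdist x (F v).
  by move=> [_ /= h]; apply: lt_le_trans h; rewrite exprn_gt0.
(* Without a value of [kappa] above 1 the unit disk itself would lie in the interior. *)
have [[v [Tv kv]]|noT] := pselect (exists v, T v /\ 1 < kappa v); last first.
  exfalso; apply: no_disk; exists c0; rewrite c0E; apply: grow => // v v01 h.
  have Tv : T v by split=> //=; rewrite in_itv.
  rewrite leNgt; apply/negP => lt; apply: noT; exists v; split => //.
  by rewrite /kappa ltr_pdivlMr ?mul1r ?(Tpos v Tv)//; rewrite mulr1 in lt.
have ck : {within T, continuous kappa}.
  apply: continuous_in_subspaceT => w /set_mem Tw; apply: cvgM.
    apply: cvgM; first exact: cvg_cst.
    by apply: cvg_dot; [exact: cvg_cst|apply: cvgB; [exact: cF|exact: cvg_cst]].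
  by apply: cvgV; [rewrite gt_eqF// Tpos|exact: cs].
have [v0 /set_mem Tv0 Hv0] := compact_EVT_max (ex_intro _ v Tv) cT ck.
have k1 : 1 < kappa v0 by apply: (lt_le_trans kv); apply: Hv0; rewrite inE.
have k0 : 0 < kappa v0 by apply: lt_trans k1.
pose r := (kappa v0)^-1.
have r0 : 0 < r by rewrite invr_gt0.
have r1 : r <= 1 by rewrite invf_le1// ltW.
have rk : r * kappa v0 = 1 by rewrite mulVf// gt_eqF.
have kE w : T w -> 2 * dot n (F w - x) = kappa w * sqdist x (F w).
  by move=> Tw; rewrite /kappa divfK// gt_eqF// Tpos.
exists v0, (x + r *: n), r; split; last first.
  by rewrite eq_sym -subr_eq0; apply: contraTneq (Tpos _ Tv0); rewrite sqdistE -/x => ->; rewrite /dot !mul0r addr0 ltxx.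
split => //.
- apply: grow => // w w01 h; have Tw : T w by split=> //=; rewrite in_itv.
  rewrite (mulrC 2) -mulrA kE// mulrA ler_piMl ?sqdist_ge0//.
  by rewrite -rk ler_pM2l// Hv0// inE.
- rewrite /ecircle/= dE -/x subrr (_ : dot n 0 = 0) ?mulr0 ?subr0.
    by rewrite sqdistE subrr /dot !mul0r !addr0 add0r.
  by rewrite /dot !mulr0 addr0.
by rewrite /ecircle/= dE (mulrC 2) -(mulrA r) kE// mulrA rk mul1r subrr add0r.
Qed.

Lemma edisk_notin c r x : edisk c r `<=` Int (range F) -> ~ edisk c r (F x).
Proof. by move=> D /D[+ _]; apply; exists x. Qed.

(* The power difference of the two circles is affine and separates the chords. *)
Lemma chords_disjoint c r c' r' a b x y l :
  ecircle c r a -> ecircle c r b -> ecircle c' r' x -> ecircle c' r' y ->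
  ~ edisk c' r' a -> ~ edisk c' r' b -> r ^+ 2 < sqdist c x -> ~ edisk c r y ->
  0 <= l < 1 -> ~ seg a b (chord x y l).
Proof.
rewrite /ecircle/edisk/= => ca cb cx cy /negP na /negP nb nx /negP ny /andP[l0 l1].
rewrite -!leNgt in na nb ny.
move=> /segP[k /andP[k0 k1] e].
have := chord_sqdist c x y l; have := chord_sqdist c' x y l.
rewrite e (chord_sqdist c) (chord_sqdist c') ca cb cx cy => e1 e2.
have : 0 <= k * (sqdist c' b - r' ^+ 2) by rewrite mulr_ge0// subr_ge0.
have : 0 <= (1 - k) * (sqdist c' a - r' ^+ 2) by rewrite mulr_ge0// subr_ge0.
have : 0 <= l * (sqdist c y - r ^+ 2) by rewrite mulr_ge0// subr_ge0.
have : 0 < (1 - l) * (sqdist c x - r ^+ 2) by rewrite mulr_gt0// subr_gt0.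
lra.
Qed.

(** Take the disk touching at the middle [u] of the arc. If its second contact [v] were on the other
    arc, the chord from [F u] to [F v] would miss the chord from [F s] to [F t]. Its midpoint could
    then be joined to [F v] off one chorded loop and to [F u] off the other, so both winding numbers
    would vanish at an interior point. *)
Lemma halving c r s t : s < t -> t < s + 1 -> inscribed F c r s t ->
  exists c' r' s' t', [/\ s <= s', s' < t', t' <= t, t' - s' <= (t - s) / 2 &
    inscribed F c' r' s' t'].
Proof.
move=> st ts ins; pose u := (s + t) / 2.
have [su ut] : s < u /\ u < t by rewrite /u; split; lra.
have [r0 DI cs ct] := ins.
have nDu : ~ edisk c r (F u) by exact: edisk_notin.
(* If the given disk already touches at [F u], it serves for the half [[s, u]]. *)
have [eu|] := eqVneq (sqdist c (F u)) (r ^+ 2).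
  by exists c, r, s, u; split=> //; rewrite /u; lra.
rewrite neq_lt => /orP[/nDu//|gtu].
have [v0 [c2 [r2 [[r20 DI2 cu2 cv2] nvu]]]] := second_contact u.
have [v vI Fv] : exists2 v, s <= v < s + 1 & F v0 = F v.
  by apply: (range_arc_lt perF); exists v0.
rewrite Fv in cv2 nvu.
have [vu|uv|vu] := ltgtP v u; last by rewrite vu eqxx in nvu.
  by exists c2, r2, v, u; split=> //; move: vI; rewrite /u; lra.
have [vt|tv] := leP v t; first by exists c2, r2, u, v; split=> //; move: vt; rewrite /u; lra.
exfalso; case/andP: vI => sv vs.
have [|nx wx] := opposite_exterior cF perF injF st ts ins (u := u); first by rewrite su.
have ts1 : s + 1 < t + 1 by rewrite ltrD2r.
have [|ny] := opposite_exterior cF perF injF ts ts1 (inscribed_shift perF ins) (u := v).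
  by rewrite tv.
rewrite chorded_shift// in ny.
rewrite wchorded_shift ?ltW// => [wy|]; last by move=> h; apply: ny; left.
pose p := mid (F u) (F v).
have xy : F u != F v by rewrite eq_sym.
have Int_chord l : 0 < l < 1 -> Int (range F) (chord (F u) (F v) l).
  by move=> l01; apply: DI2; apply/chord_edisk.
have off l : 0 <= l < 1 -> ~ seg (F s) (F t) (chord (F u) (F v) l).
  by apply: (chords_disjoint cs ct cu2 cv2) => //; exact: edisk_notin.
have nrange l : 0 < l < 1 -> forall s t, ~ arc F s t (chord (F u) (F v) l).
  by move=> /Int_chord[nr _] s' t' /arcP[w _ e]; apply: nr; exists w.
have pI : Int (range F) p by apply: Int_chord; lra.
have chord_half (a b : R * R) l : chord a (mid a b) l = chord a b (l / 2).
  by rewrite /mid /chord/=; congr pair; rewrite /=/GRing.scale/=/GRing.scale/=; field.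
have w1 : wchorded F s t (F v) = wchorded F s t p.
  apply: (@seg_const _ _ (~` chorded F s t)).
    by move=> z; apply: wchorded_near => //; exact: ltW.
  rewrite /p mid_sym => z /segP[l /andP[l0 l1] ->].
  have [->|ln0] := eqVneq l 0; first by rewrite chord0.
  have lp : 0 < l by rewrite lt_neqAle eq_sym ln0.
  rewrite chord_half -chord_rev => -[|].
    by apply: nrange; lra.
  by rewrite seg_sym; apply: off; lra.
have w2 : wchorded F t (s + 1) (F u) = wchorded F t (s + 1) p.
  apply: (@seg_const _ _ (~` chorded F t (s + 1))).
    by move=> z; apply: wchorded_near => //; exact: ltW.
  move=> z /segP[l /andP[l0 l1] ->].
  have [->|ln0] := eqVneq l 0; first by rewrite chord0.
  have lp : 0 < l by rewrite lt_neqAle eq_sym ln0.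
  rewrite chord_half => -[|].
    by apply: nrange; lra.
  by rewrite perF; apply: off; lra.
apply: (wcurve_Int cF perF injF (s := s) pI).
rewrite (wchordedD cF perF (ltW st) (ltW ts)) -?w1 -?w2 ?wy ?wx ?addr0//.
  by rewrite -range_arc//; case: pI.
by apply: off; lra.
Qed.

End Contacts.

(** * No inscribed disk of radius well below 1 on a short arc *)

Section ShortArc.
Context {R : realType}.
Implicit Types (a b c n y z : R * R) (r s t u : R).

Lemma dot_le (u v : R * R) (A B : R) : 0 <= A -> 0 <= B ->
  dot u u <= A ^+ 2 -> dot v v <= B ^+ 2 -> dot u v <= A * B.
Proof.
move=> A0 B0 uA vB; have [h|/ltW h] := leP (dot u v) 0.
  by apply: (le_trans h); exact: mulr_ge0.
rewrite -ler_sqr ?nnegrE ?mulr_ge0// exprMn; apply: (le_trans (cauchy_schwarz u v)).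
by apply: ler_pM; rewrite ?dot_ge0.
Qed.

(* Two circles through the origin with inner normals n and - n': as n' is
   shorter, the unit disk of center n is not locally contained in the disk of
   center - n'.  The point w is taken on the circle of diameter n - n'. *)
Lemma lens_escape (n n' : R * R) (mu : R) : dot n n = 1 -> dot n' n' < 1 -> 0 < mu ->
  exists w : R * R, [/\ dot w w < mu ^+ 2, dot w w < 2 * dot w n &
    0 < dot w w + 2 * dot w n'].
Proof.
move=> n1 n'1 mu0; pose N := n - n'.
have [sg sg1 sgN] : exists2 sg : R, sg ^+ 2 = 1 & 0 <= sg * dot (perp N) (n + n').
  have [h|/ltW h] := leP 0 (dot (perp N) (n + n')).
    by exists 1; rewrite ?mul1r// expr1n.
  by exists (-1); rewrite ?mulN1r ?oppr_ge0// sqrrN expr1n.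
(* Since [dot w w] equals [dot w n - dot w n'], both inequalities reduce to
   [0 < dot w n + dot w n'], which the sign [sg] ensures; the size of [k] makes [w] shorter than
   [mu]. *)
pose k := 1 + dot N N / mu ^+ 2; pose sig := (1 + k ^+ 2)^-1.
have mu2 : 0 < mu ^+ 2 by rewrite exprn_gt0.
have q0 : 0 <= dot N N / mu ^+ 2 by rewrite divr_ge0 ?dot_ge0 ?ltW.
have k0 : 1 <= k by rewrite lerDl.
have kk : 0 < 1 + k ^+ 2 by nra.
have sig0 : 0 < sig by rewrite invr_gt0.
pose w : R * R := (sig * (N.1 + k * sg * (perp N).1), sig * (N.2 + k * sg * (perp N).2)).
have ww : dot w w = sig * dot N N.
  have -> : dot w w = sig * (sig * (1 + k ^+ 2 * sg ^+ 2)) * dot N N.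
    by rewrite /w /perp /dot/=; ring.
  by rewrite sg1 mulr1 mulVf ?gt_eqF// mulr1.
have wN : dot w n - dot w n' = sig * dot N N.
  by rewrite /w /perp /dot/=; ring.
have wp : 0 < dot w n + dot w n'.
  have -> : dot w n + dot w n' =
      sig * ((dot n n - dot n' n') + k * (sg * dot (perp N) (n + n'))).
    by rewrite /w /N /perp /dot/=; ring.
  rewrite mulr_gt0// n1 ltr_wpDr ?subr_gt0//.
  by rewrite mulr_ge0//; lra.
exists w; split; rewrite ww; [|lra|lra].
rewrite /sig mulrC ltr_pdivrMr//.
have e : dot N N = (k - 1) * mu ^+ 2 by rewrite /k addrAC subrr add0r divfK// gt_eqF.
by rewrite e; nra.
Qed.

Variable F : R -> R * R.
Hypothesis cF : continuous F.
Hypothesis perF : forall x, F (x + 1) = F x.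
Hypothesis injF : forall x y : R, `|x - y| < 1 -> F x = F y -> x = y.
Hypothesis bcc : bounded_convex_curvature (range F).

(** On one side of the chord the chorded loop has nonzero winding number. A perpendicular ray from
    the midpoint to that side that missed the arc would carry this value to points where it is 0. *)
Lemma ray_meets_arc c r s t : s < t -> t < s + 1 -> inscribed F c r s t ->
  exists sg tau v, [/\ sg ^+ 2 = 1 :> R, 0 < tau, s <= v <= t &
    F v = mid (F s) (F t) + (sg * tau) *: perp (F t - F s)].
Proof.
move=> st ts ins.
set a := F s; set b := F t; set m := mid a b; set nu := perp (b - a).
have ab : a != b by exact: neqF.
have pm := chorded_pm cF perF injF st ts ins.
have [sg sg1 sgw] : exists2 sg : R, sg = 1 \/ sg = -1 &
    Var (fun x => F x - m) s t - sg * pi <> 0.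
  have p0 := @pi_gt0 R; case: pm => ->; [exists (-1)|exists 1]; try by [left|right].
    lra.
  lra.
have sq1 : sg ^+ 2 = 1 by case: sg1 => ->; ring.
apply: contrapT => noray.
have {}noray tau : 0 < tau -> ~ arc F s t (m + (sg * tau) *: nu).
  by move=> t0 /arcP[v vI e]; apply: noray; exists sg, tau, v.
have nu0 := dot_nu_gt0 injF st ts; rewrite -/a -/b -/nu in nu0.
have side tau : dot (m + (sg * tau) *: nu - m) nu = sg * tau * dot nu nu.
  by rewrite /dot/=/GRing.scale/=/GRing.scale/=; ring.
have off tau : 0 < tau -> ~ chorded F s t (m + (sg * tau) *: nu).
  move=> t0 [|/segP[x _ e]]; first exact: noray.
  have : dot (chord b a x - m) nu = 0.
    by rewrite /dot /chord /m /nu /mid /chord/=/GRing.scale/=/GRing.scale/=; field.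
  rewrite -/a -/b in e; rewrite -e side => /eqP.
  rewrite !mulf_eq0 (gt_eqF t0) (gt_eqF nu0) !orbF => /eqP e0.
  by rewrite e0 expr0n/= in sq1; move/eqP: sq1; rewrite eq_sym oner_eq0.
have [d d0 Hd] := mid_offset injF st ts ins (sg *: nu).
have [M M0 HM] := range_bounded cF perF.
(* [T] is chosen from twice the squared norm of [m + X] being at least that of [X] minus twice that
   of [m], with [X] the displacement along the ray. *)
pose K := 2 * M + 2 * dot m m; pose T := K / dot nu nu + 1.
have K0 : 0 <= K by rewrite /K addr_ge0// mulr_ge0// ?dot_ge0// ltW.
have T1 : 1 <= T by rewrite lerDr divr_ge0// ltW.
have far : M <= dot (m + (sg * T) *: nu) (m + (sg * T) *: nu).
  have eT : (T - 1) * dot nu nu = K by rewrite /T addrK divfK// gt_eqF.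
  have : 0 <= dot (m + m + (sg * T) *: nu) (m + m + (sg * T) *: nu) by exact: dot_ge0.
  have -> : dot (m + m + (sg * T) *: nu) (m + m + (sg * T) *: nu) =
     2 * dot (m + (sg * T) *: nu) (m + (sg * T) *: nu) + 2 * dot m m - (sg ^+ 2 * (T * (T * dot nu nu))).
    by rewrite /dot/=/GRing.scale/=/GRing.scale/=; ring.
  rewrite sq1 mul1r.
  have : K <= T * (T * dot nu nu) by nra.
  rewrite /K; lra.
have d2 : 0 < d / 2 by rewrite divr_gt0.
have w0 : wchorded F s t (m + (sg * (d / 2)) *: nu) = 0.
  rewrite -(wchorded_far cF (ltW st) HM far).
  apply: (@seg_const _ _ (~` chorded F s t)).
    by move=> z nz; apply: wchorded_near => //; exact: ltW.
  move=> z /segP[x /andP[x0 x1] ->].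
  have -> : chord (m + (sg * (d / 2)) *: nu) (m + (sg * T) *: nu) x =
      m + (sg * ((1 - x) * (d / 2) + x * T)) *: nu.
    by rewrite /chord; congr pair; rewrite /=/GRing.scale/=/GRing.scale/=; ring.
  by apply: off; nra.
apply: sgw; rewrite -w0; symmetry; apply: (side_value cF injF st ts ins sg1).
  by rewrite (mulrC sg) -scalerA; apply: Hd; lra.
rewrite side -/a -/b (_ : sg * _ = sg ^+ 2 * (d / 2 * dot nu nu)); last by ring.
by rewrite sq1 mul1r mulr_gt0.
Qed.

(** The curvature condition fails at the arc point farthest from the center [q] of a flatter circle
    through [F s] and [F t]. The strict gap between [r] and [rho] makes the arc leave that circle,
    and [rho + eta <= 1] keeps the farthest distance below 1. *)
Lemma short_arc c r s t (rho eta : R) : s < t -> t < s + 1 -> inscribed F c r s t ->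
  r < rho -> 0 < eta -> rho + eta <= 1 ->
  (forall x, s <= x <= t -> sqdist (F s) (F x) < eta ^+ 2) -> False.
Proof.
move=> st ts ins rrho eta0 rhoeta small.
have [r0 DI cs ct] := ins.
have ab : F s != F t by exact: neqF.
have [sg [tau [v [sq1 tau0 vI Fv]]]] := ray_meets_arc st ts ins.
move: Fv; set m := mid _ _ => Fv.
pose l : R * R := sg *: perp (F t - F s).
pose L := dot (F t - F s) (F t - F s).
have L0 : 0 < L by apply: dot_gt0; rewrite subr_eq0 eq_sym.
have L0' := lt0r_neq0 L0.
have ll : dot l l = L.
  by rewrite -[RHS]mul1r -sq1 /L /l /perp /dot/=/GRing.scale/=/GRing.scale/=; ring.
have end_dist h : sqdist (m + h *: l) (F s) = L / 4 + h ^+ 2 * L /\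
    sqdist (m + h *: l) (F t) = L / 4 + h ^+ 2 * L.
  have -> : L / 4 + h ^+ 2 * L = L / 4 + h ^+ 2 * (sg ^+ 2 * L) by rewrite sq1 mul1r.
  by split; rewrite /L /l /perp /m /mid /chord /sqdist /dot/=/GRing.scale/=/GRing.scale/=; field.
have ray_dist h h' : sqdist (m + h *: l) (m + h' *: l) = (h' - h) ^+ 2 * L.
  by rewrite -ll /sqdist /dot/=/GRing.scale/=/GRing.scale/=; ring.
have [h cE] : exists h, c = m + h *: l.
  have e : sqdist c (F s) = sqdist c (F t) by rewrite cs ct.
  have orth : dot (c - m) (F t - F s) = 0.
    have -> : dot (c - m) (F t - F s) = (sqdist c (F s) - sqdist c (F t)) / 2.
      by rewrite /m /mid /chord /sqdist /dot/=/GRing.scale/=/GRing.scale/=; field.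
    by rewrite e subrr mul0r.
  exists (dot (c - m) l / L).
  suff : c - m = (dot (c - m) l / L) *: l by move=> <-; rewrite addrC subrK.
  have w1 : (c - m).1 * L = dot (c - m) l * l.1.
    transitivity ((c - m).1 * L + dot (c - m) (F t - F s) * (0 - (F t - F s).1)).
      by rewrite orth mul0r addr0.
    have -> : dot (c - m) l * l.1 = sg ^+ 2 * (dot (c - m) (perp (F t - F s)) * (perp (F t - F s)).1).
      by rewrite /l /dot/=/GRing.scale/=/GRing.scale/=; ring.
    by rewrite sq1 /L /perp /dot/=; ring.
  have w2 : (c - m).2 * L = dot (c - m) l * l.2.
    transitivity ((c - m).2 * L + dot (c - m) (F t - F s) * (0 - (F t - F s).2)).
      by rewrite orth mul0r addr0.
    have -> : dot (c - m) l * l.2 = sg ^+ 2 * (dot (c - m) (perp (F t - F s)) * (perp (F t - F s)).2).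
      by rewrite /l /dot/=/GRing.scale/=/GRing.scale/=; ring.
    by rewrite sq1 /L /perp /dot/=; ring.
  rewrite [LHS]surjective_pairing; congr pair.
    rewrite -[RHS]/(dot (c - m) l / L * l.1) mulrAC -w1 mulfK//.
  rewrite -[RHS]/(dot (c - m) l / L * l.2) mulrAC -w2 mulfK//.
have rE : r ^+ 2 = L / 4 + h ^+ 2 * L by rewrite -cs cE (end_dist h).1.
have {}Fv : F v = m + tau *: l by rewrite Fv /l scalerA mulrC.
have out : L / 4 <= (tau ^+ 2 - 2 * tau * h) * L.
  have : r ^+ 2 <= sqdist c (F v).
    by rewrite leNgt; apply/negP; exact: (inscribed_disjoint ins).
  rewrite rE cE Fv ray_dist; lra.
(* Centers of circles through both endpoints are [m + h *: l]. Radius [rho] gives the heights [k]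
   and [- k]; the lower one is below the height [h] of [c], so this circle bulges less towards
   [F v]. *)
pose k := Num.sqrt ((rho ^+ 2 - L / 4) / L).
have rho0 : 0 < rho by apply: lt_trans rrho.
have hk2 : h ^+ 2 < (rho ^+ 2 - L / 4) / L by rewrite ltr_pdivlMr//; nra.
have k2 : k ^+ 2 = (rho ^+ 2 - L / 4) / L.
  by rewrite sqr_sqrtr// ltW//; apply: le_lt_trans hk2; exact: sqr_ge0.
have k0 : 0 <= k by exact: sqrtr_ge0.
have hk : - k < h.
  by rewrite ltNge; apply/negP => hk; move: hk2; rewrite -k2; nra.
pose q := m + (- k) *: l.
have qrho : L / 4 + (- k) ^+ 2 * L = rho ^+ 2.
  by rewrite sqrrN k2 divfK//; ring.
have [qs qt] : sqdist q (F s) = rho ^+ 2 /\ sqdist q (F t) = rho ^+ 2.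
  by rewrite /q !(end_dist _).1 !(end_dist _).2 qrho.
have qv : rho ^+ 2 < sqdist q (F v).
  rewrite /q Fv ray_dist -qrho.
  have : 0 < tau * (h + k) * L by rewrite !mulr_gt0//; lra.
  lra.
have cq : {within `[s, t]%classic, continuous (fun x => sqdist q (F x))}.
  apply: continuous_subspaceT => x.
  rewrite (_ : (fun v => _) = fun v => dot (q - F v) (q - F v)); last first.
    by apply/funext => w; rewrite sqdistE.
  by apply: cvg_dot; apply: cvgB; (try exact: cvg_cst); exact: cF.
have [u uI Hu] := EVT_max (ltW st) cq.
rewrite in_itv/= in uI.
have Rq : rho ^+ 2 < sqdist q (F u) by apply: (lt_le_trans qv); apply: Hu; rewrite in_itv.
have su : s < u.
  by case/andP: uI; rewrite le_eqVlt => /orP[/eqP su|//]; rewrite -su qs ltxx in Rq.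
have ut : u < t.
  by case/andP: uI => _; rewrite le_eqVlt => /orP[/eqP ut|//]; rewrite ut qt ltxx in Rq.
have R1 : sqdist q (F u) < 1.
  have h1 : dot (q - F s) (F s - F u) <= rho * eta.
    apply: dot_le; [exact: ltW|exact: ltW|by rewrite -sqdistE qs|].
    by rewrite -sqdistE; apply: ltW; exact: small.
  have h2 := small u uI.
  have -> : sqdist q (F u) = sqdist q (F s) + 2 * dot (q - F s) (F s - F u) + sqdist (F s) (F u).
    by rewrite /sqdist /dot/=; ring.
  rewrite qs; apply: (@lt_le_trans _ _ ((rho + eta) ^+ 2)); first by lra.
  by rewrite expr_le1// addr_ge0// ltW.
(* Near [F u] the loop of the complementary arc contributes nothing, so only the loop of the short
   arc matters. *)
have [|nJ wJ] := opposite_exterior cF perF injF st ts ins (u := u); first by rewrite su.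
have nr : \forall y \near F u, wchorded F t (s + 1) y = 0.
  by rewrite -wJ; apply: wchorded_near => //; exact: ltW.
have /nbhs_ballP[d /= d0 Hd] := nr.
have [|c' [c'u [e e0 De]]] := bcc (x := F u); first by exists u.
have n1 : dot (c' - F u) (c' - F u) = 1.
  by rewrite -sqdistE; move: c'u; rewrite /ecircle/= expr1n.
have n'1 : dot (F u - q) (F u - q) < 1.
  by rewrite (_ : dot _ _ = sqdist q (F u))// /sqdist /dot/=; ring.
have mu0 : 0 < Num.min d e by rewrite lt_min d0.
have [w [ww w1 w2]] := lens_escape n1 n'1 mu0.
have md : Num.min d e <= d by rewrite ge_min lexx.
have me : Num.min d e <= e by rewrite ge_min lexx orbT.
pose z := F u + w.
have zI : Int (range F) z.
  apply: De; split; rewrite /edisk/=.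
    rewrite (_ : sqdist _ _ = dot w w); last by rewrite /sqdist /z /dot/=; ring.
    by apply: (lt_le_trans ww); rewrite ler_sqr ?nnegrE// ltW.
  rewrite (_ : sqdist _ _ = dot (c' - F u) (c' - F u) - 2 * dot w (c' - F u) + dot w w).
    by rewrite n1 expr1n; lra.
  by rewrite /sqdist /z /dot/=; ring.
have qz : sqdist q (F u) < sqdist q z.
  rewrite (_ : sqdist q z = sqdist q (F u) + (dot w w + 2 * dot w (F u - q))); first by lra.
  by rewrite /sqdist /z /dot/=; ring.
(* The loop of the short arc stays within distance [sqdist q (F u)] (squared) of [q], and [z] is
   farther away, so the loop lies in an open half-plane seen from [z]. *)
have inside y : chorded F s t y -> 0 < dot (q - z) (y - z).
  move=> Jy; rewrite (_ : y - z = (q - z) + (y - q)); last by rewrite [RHS]addrC addrA subrK.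
  apply: dot_perturb; rewrite -(sqdistE q z) -sqdistE.
  rewrite (_ : sqdist y q = sqdist q y); last by rewrite /sqdist; ring.
  apply: le_lt_trans qz; case: Jy => [/arcP[x xI ->]|/segP[x /andP[x0 x1] ->]].
    by apply: Hu; rewrite in_itv.
  rewrite chord_sqdist qs qt; apply: (le_trans _ (ltW Rq)).
  have : 0 <= x * (1 - x) * sqdist (F t) (F s) by rewrite !mulr_ge0 ?subr_ge0 ?sqdist_ge0.
  lra.
have wz : wchorded F s t z = 0 := wchorded_halfplane cF (ltW st) inside.
have wz' : wchorded F t (s + 1) z = 0.
  apply: Hd; apply/ball_pairE; rewrite /z/= !opprD !addNKr !normrN.
  have wd : dot w w < d ^+ 2 by apply: (lt_le_trans ww); rewrite ler_sqr ?nnegrE// ltW.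
  have aux (p : R) : p ^+ 2 < d ^+ 2 -> `|p| < d.
    by move=> h0; rewrite -ltr_sqr ?nnegrE ?(ltW d0)// real_normK ?num_real.
  move: wd; rewrite /dot; have := sqr_ge0 w.1; have := sqr_ge0 w.2.
  by split; apply: aux; lra.
apply: (wcurve_Int cF perF injF (s := s) zI).
rewrite (wchordedD cF perF (ltW st) (ltW ts)) ?wz ?wz' ?addr0//.
  by rewrite -range_arc//; case: zI.
rewrite seg_sym => /(@or_intror (arc F s t z))/inside.
by rewrite subrr /dot !mulr0 addr0 ltxx.
Qed.

End ShortArc.

(** * Inradius, arbitrarily short arcs and the contradiction *)

Section Assembly.
Context {R : realType} (F : R -> R * R).
Hypothesis cF : continuous F.
Hypothesis perF : forall x, F (x + 1) = F x.
Hypothesis injF : forall x y : R, `|x - y| < 1 -> F x = F y -> x = y.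
Hypothesis bcc : bounded_convex_curvature (range F).
Hypothesis no_disk : ~ exists c : R * R, edisk c 1 `<=` Int (range F).

Lemma edisk_le (c : R * R) (r r' : R) : 0 <= r <= r' -> edisk c r `<=` edisk c r'.
Proof. by move=> rr y; rewrite /edisk/= => h; apply: (lt_le_trans h); nra. Qed.

(** The pairs (center, radius at most 1) of disks in the interior form a compact set: a point of a
    limit disk lies in nearby disks of the set. The maximal radius is attained, so it is not 1. *)
Lemma inradius_lt1 : exists2 rho : R, rho < 1 &
  forall c r, 0 < r -> edisk c r `<=` Int (range F) -> r <= rho.
Proof.
have [M M0 HM] := range_bounded cF perF.
pose I : set R := `[- (M + 1), M + 1]%classic.
pose E : set (R * R * R) :=
  ((I `*` I) `*` `[0, 1]%classic) `&` [set p | edisk p.1 p.2 `<=` Int (range F)].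
have cE : compact E.
  apply: compact_closedI.
    by apply: compact_setX; [apply: compact_setX|]; exact: segment_compact.
  move=> p cp y; rewrite /edisk/= => yp.
  have cq : (fun q : R * R * R => q.2 ^+ 2 - sqdist q.1 y) @ p --> p.2 ^+ 2 - sqdist p.1 y.
    apply: cvgB; first by apply: cvgM; exact: cvg_snd.
    have c1 : (fun q : R * R * R => q.1) @ p --> p.1 by exact: cvg_fst.
    rewrite sqdistE (_ : (fun q => _) = fun q : R * R * R => dot (q.1 - y) (q.1 - y)); last first.
      by apply/funext => q; rewrite sqdistE.
    by apply: cvg_dot; apply: cvgB => //; exact: cvg_cst.
  have : \forall q \near p, 0 < q.2 ^+ 2 - sqdist q.1 y.
    by apply: (cvgr_gt _ cq); rewrite subr_gt0.
  by move=> /cp[q [/= Dq]]; rewrite subr_gt0 => /Dq.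
(* The disk of radius 0 is empty, so it makes the set nonempty. *)
have E0 : E ((0, 0), 0).
  split; first by rewrite /I/= !in_itv/=; split; [split|]; lra.
  by move=> y; rewrite /edisk/= expr0n/= ltNge sqdist_ge0.
have cs : {within E, continuous (fun p : R * R * R => p.2)}.
  by apply: continuous_subspaceT => p; exact: cvg_snd.
have [p /set_mem[[_ p2] Dp] Hp] := compact_EVT_max (ex_intro _ _ E0) cE cs.
move: p2; rewrite /= in_itv/= => /andP[p20 p21].
exists p.2.
  rewrite lt_neqAle p21 andbT; apply/eqP => p1; apply: no_disk.
  by exists p.1; rewrite -p1.
move=> c r r0 D; have r1 : r <= 1.
  rewrite leNgt; apply/negP => r1; apply: no_disk; exists c.
  by apply: subset_trans D; apply: edisk_le; rewrite ler01 ltW.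
have cc : dot c c < M.
  apply: (Int_bounded cF perF injF HM); apply: D.
  by rewrite /edisk/= sqdistE subrr /dot !mulr0 addr0 exprn_gt0.
have : (c, r) \in E.
  rewrite inE; split => //=; rewrite /I/= !in_itv/=; move: cc; rewrite /dot => cc.
  by split; [split|]; apply/andP; split; nra.
exact: Hp.
Qed.

Lemma inscribed_pairs (n : nat) : exists c r s t,
  [/\ 0 <= s, s < t, t < s + 1, t <= 1 & t - s <= n.+1%:R^-1] /\ inscribed F c r s t.
Proof.
elim: n => [|n [c [r [s [t [[s0 st ts t1 tsn] ins]]]]]].
  have [v0 [c [r [[r0 D c0 cv] nv]]]] := second_contact cF perF bcc no_disk 0.
  have [v /andP[v0' v1] Fv] : exists2 v, 0 <= v < 0 + 1 & F v0 = F v.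
    by apply: (range_arc_lt perF); exists v0.
  rewrite Fv in cv nv; exists c, r, 0, v; split=> //; rewrite invr1; split=> //; try lra.
  by rewrite lt_neqAle v0' andbT; apply: contra nv => /eqP <-.
have [c' [r' [s' [t' [ss' st' tt' ts' ins']]]]] := halving cF perF injF bcc no_disk st ts ins.
exists c', r', s', t'; split => //.
(* Halving beats the passage from [n.+1] to [n.+2]; any bound tending to 0 is enough. *)
have h : n.+1%:R^-1 / 2 <= n.+2%:R^-1 :> R.
  rewrite -invfM lef_pV2 ?posrE ?mulr_gt0 ?ltr0n//.
  by rewrite -natrM ler_nat muln2 -addnn addSn ltnS leq_addl.
move: h tsn; move: (n.+1%:R^-1) (n.+2%:R^-1) => p q h tsn.
by split=> //; lra.
Qed.

Lemma no_disk_False : False.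
Proof.
have [rho rho1 Hrho] := inradius_lt1.
(* [short_arc] is applied with [rho + eta] as its radius, so that [rho + 2 eta = 1] and [r] is
   strictly smaller. *)
pose eta := (1 - rho) / 2; have eta0 : 0 < eta by rewrite divr_gt0// subr_gt0.
have [|d d0 Hd] := @compact_uniform _ R^o (fun p => sqdist (F p.1) (F p.2) < eta ^+ 2) _ (@segment_compact R 0 1).
  move=> x _; have cq : (fun p : R * R => sqdist (F p.1) (F p.2)) @ (x, x) --> sqdist (F x) (F x).
    rewrite sqdistE (_ : (fun p => _) = fun p : R * R => dot (F p.1 - F p.2) (F p.1 - F p.2)); last first.
      by apply/funext => q; rewrite sqdistE.
    have c1 : (fun p : R * R => F p.1) @ (x, x) --> F x.
      by apply: (@cvg_comp _ _ _ fst F); [exact: cvg_fst|exact: cF].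
    have c2 : (fun p : R * R => F p.2) @ (x, x) --> F x.
      by apply: (@cvg_comp _ _ _ snd F); [exact: cvg_snd|exact: cF].
    by apply: cvg_dot; apply: cvgB.
  apply: (cvgr_lt _ cq).
  by rewrite sqdistE subrr /dot !mulr0 addr0 exprn_gt0.
pose n := Num.truncn d^-1.
have nd : n.+1%:R^-1 < d.
  by rewrite invf_plt ?posrE ?ltr0n// truncnS_gt.
have [c [r [s [t [[s0 st ts t1 tsn] ins]]]]] := inscribed_pairs n.
have tsd := le_lt_trans tsn nd.
have rrho : r <= rho by case: (ins) => r0 D _ _; exact: Hrho D.
apply: (short_arc cF perF injF bcc st ts ins (rho := rho + eta) (eta := eta)) => //.
- by lra.
- by rewrite /eta; lra.
move=> x xI; apply: (Hd s x); first by rewrite /= in_itv/=; lra.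
by rewrite ltr_norml; lra.
Qed.

End Assembly.

(** Composing [f] with the fractional part frees later arguments from a base point: arcs may start
    anywhere, and simplicity becomes injectivity at parameter distance below 1. *)
Lemma periodic_extension (R : realType) (f : R -> R * R) : jordan_param f ->
  exists F : R -> R * R, [/\ continuous F, forall x, F (x + 1) = F x,
    forall x y : R, `|x - y| < 1 -> F x = F y -> x = y & range F = curve f].
Proof.
move=> [cf f01 injf].
(* The retraction of the line onto [0, 1], which turns continuity of [f] within the segment into
   continuity on the line. *)
pose clamp (x : R) := (`|x| - `|x - 1| + 1) / 2.
have clamp0 x : x <= 0 -> clamp x = 0.
  by move=> x0; rewrite /clamp !ler0_norm; lra.
have clamp1 x : 1 <= x -> clamp x = 1.
  by move=> x1; rewrite /clamp !ger0_norm; lra.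
have clampE x : 0 <= x <= 1 -> clamp x = x.
  by move=> x01; rewrite /clamp ger0_norm ?ler0_norm; lra.
have clampI x : 0 <= clamp x <= 1.
  have [/clamp0->|x0] := leP x 0; first lra.
  have [/clamp1->|x1] := leP 1 x; first lra.
  by rewrite clampE; lra.
have cclamp : continuous clamp.
  move=> x; apply: cvgM; last exact: cvg_cst.
  apply: cvgD; last exact: cvg_cst.
  apply: cvgB; apply: cvg_norm; first exact: cvg_id.
  by apply: cvgB; [exact: cvg_id|exact: cvg_cst].
have cfc : continuous (f \o clamp).
  apply/continuous_closedP => C cC.
  move/continuous_closedP : cf => /(_ _ cC) /closed_subspaceP[V cV VE].
  rewrite (_ : (f \o clamp) @^-1` C = clamp @^-1` V).
    by apply: closed_comp => // x _; exact: cclamp.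
  apply/seteqP; split => x /= h.
    have : (f @^-1` C `&` `[0, 1]%classic) (clamp x) by split=> //=; rewrite in_itv/= clampI.
    by rewrite -VE => -[].
  have : (V `&` `[0, 1]%classic) (clamp x) by split=> //=; rewrite in_itv/= clampI.
  by rewrite VE => -[].
pose F x := f (x - (Num.floor x)%:~R).
have fl (x : R) : (Num.floor x)%:~R <= x < (Num.floor x)%:~R + 1.
  have := floor_le_tmp x; have := floorD1_gt x; rewrite intrD => -> -> //.
have flE (x : R) (k : int) : k%:~R <= x < k%:~R + 1 -> Num.floor x = k.
  by move=> h; apply: floor_def; rewrite intrD.
exists F; split.
- move=> x; pose k := Num.floor x.
  (* A continuous expression for [F] on both sides of the integer [k]: one of the first two terms
     always equals [f 1], by [f 0 = f 1], and is subtracted. *)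
  pose G y := f (clamp (y - k%:~R)) + f (clamp (y - k%:~R + 1)) - f 1.
  have cG : {for x, continuous G}.
    apply: cvgB; last exact: cvg_cst.
    apply: cvgD.
      apply: (@cvg_comp _ _ _ (fun y => y - k%:~R) (f \o clamp)); last exact: cfc.
      by apply: cvgB; [exact: cvg_id|exact: cvg_cst].
    apply: (@cvg_comp _ _ _ (fun y => y - k%:~R + 1) (f \o clamp)); last exact: cfc.
    by apply: cvgD; [apply: cvgB; [exact: cvg_id|exact: cvg_cst]|exact: cvg_cst].
  have FG y : k%:~R - 1 < y < k%:~R + 1 -> F y = G y.
    move=> /andP[y1 y2]; rewrite /F /G; have [h|h] := leP k%:~R y.
      rewrite (flE y k) ?h// [clamp (_ + 1)]clamp1; last lra.
      by rewrite addrK clampE//; lra.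
    rewrite (flE y (k - 1)); last by rewrite intrB; lra.
    rewrite [clamp (_ - _)]clamp0; last lra.
    by rewrite f01 addrAC subrr add0r clampE ?intrB ?opprB ?addrA; [rewrite addrAC|lra].
  have xI := fl x; rewrite -/k in xI.
  move=> A; rewrite (FG x); last lra.
  move=> /cG nA.
  have nI : \forall y \near x, k%:~R - 1 < y < k%:~R + 1.
    have : `]k%:~R - 1, k%:~R + 1[%classic x by rewrite /= in_itv/=; lra.
    move=> xo; have := open_nbhs_nbhs (conj (itv_open (k%:~R - 1 : R) (k%:~R + 1)) xo).
    by apply: filterS => y; rewrite /= in_itv.
  change (nbhs x (F @^-1` A)).
  by apply: filterS (filterI nI nA) => y [/FG yE]; rewrite /= yE.
- move=> x; rewrite /F (flE (x + 1) (Num.floor x + 1)); last first.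
    by rewrite intrD; have := fl x; lra.
  by congr f; rewrite intrD; ring.
- move=> x y xy Fxy.
  have fracI (z : R) : z - (Num.floor z)%:~R \in `[0, 1[.
    by rewrite in_itv/=; have := fl z; lra.
  have e := injf _ _ (fracI x) (fracI y) Fxy.
  have xyE : x - y = (Num.floor x - Num.floor y)%:~R by rewrite intrB; lra.
  move: xy; rewrite xyE -intr_norm (ltr_int R _ 1) -[1%R]add0r ltzD1 normr_le0 => /eqP k0.
  by apply/eqP; rewrite -subr_eq0 xyE k0.
apply/seteqP; split => y.
  move=> [x _ <-]; exists (x - (Num.floor x)%:~R) => //=.
  by rewrite in_itv/=; have := fl x; lra.
move=> [x /=]; rewrite in_itv/= => /andP[x0 x1] <-.
move: x1; rewrite le_eqVlt => /orP[/eqP->|x1].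
  by exists 0 => //; rewrite /F (flE 0 0) ?subr0//; lra.
by exists x => //; rewrite /F (flE x 0) ?subr0//; rewrite x0 add0r.
Qed.

Theorem theorem1 (R : realType) (f : R -> R * R) :
  jordan_param f ->
  bounded_convex_curvature (curve f) ->
  exists c : R * R, edisk c 1 `<=` Int (curve f).
Proof.
move=> /periodic_extension[F [cF perF injF <-]] bcc.
by apply: contrapT => no_disk; exact: (no_disk_False cF perF injF bcc no_disk).
Qed.
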